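(* Let $(U_n)$ be the signal process and $\{V_n^{(k)}\}_{k=1}^K$ the ETKF ensemble process described in the context, and put $X_n=(U_n,V_n^{(1)},\dots,V_n^{(K)})$. Assume: (a) (Kinetic energy principle) there exist $\beta_h\in(0,1)$, $K_h>0$ with $|\Psi_h(u)|^2+\mathrm{tr}(R_h(u))\le(1-\beta_h)|u|^2+K_h$ for all $u\in\mathbb{R}^d$. (b) (Nondegenerate system noise) for any $M_1,M_2>0$ there is $\alpha>0$ such that $\mathbb{P}(\zeta_n\in\cdot\mid U_{n-1}=u)\ge\alpha\,\lambda_{M_2}(\cdot)$ for all $|u|\le M_1$, where $\lambda_{M_2}$ is Lebesgue measure on $\mathbb{R}^d$ restricted to $\{x:|x|\le M_2\}$. (c) (Strong Lyapunov function) there are a function $\mathcal{E}:\mathbb{R}^d\times\mathbb{R}^{d\times K}\to[0,\infty)$ with compact sub-level sets and constants $\beta\in(0,1)$, $c>0$ such that $\mathbb{E}_{n-1}\mathcal{E}(X_n)\le(1-\beta)\mathcal{E}(X_{n-1})+c$ for all $n\ge1$ (for every initial condition). Then the ETKF signal-ensemble process $X_n$ is geometrically ergodic.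
   Context: Signal and observations. Fix $h>0$, integers $1\le q\le d$, $K\ge2$, and $H\in\mathbb{R}^{q\times d}$ of rank $q$. $\Psi_h:\mathbb{R}^d\to\mathbb{R}^d$ is a measurable map. The signal in $\mathbb{R}^d$ and observation in $\mathbb{R}^q$ are $$U_n=\Psi_h(U_{n-1})+\zeta_n,\qquad Z_n=HU_n+\xi_n .$$ Given the past up to time $n-1$, the law of $\zeta_n$ depends only on $U_{n-1}$ (through a time-independent kernel); given $U_{n-1}=u$ it has mean $0$ and covariance matrix $R_h(u)$. The $\xi_n$ are i.i.d. with mean $0$ and covariance $I_q$, independent of everything else. ETKF. Given $\{V_{n-1}^{(k)}\}_{k=1}^K\subset\mathbb{R}^d$: Forecast: $\widehat V_n^{(k)}=\Psi_h(V_{n-1}^{(k)})+\zeta_n^{(k)}$, where $\zeta_n^{(k)}$ has the conditional law that $\zeta_n$ has given $U_{n-1}=V_{n-1}^{(k)}$; given the past up to time $n-1$, the noises $\zeta_n,\zeta_n^{(1)},\dots,\zeta_n^{(K)},\xi_n$ are independent. Put $\overline{\widehat V}_n=\frac1K\sum_k\widehat V_n^{(k)}$, $\widehat S_n=[\widehat V_n^{(1)}-\overline{\widehat V}_n,\dots,\widehat V_n^{(K)}-\overline{\widehat V}_n]\in\mathbb{R}^{d\times K}$, $\widehat C_n=\frac1{K-1}\widehat S_n\widehat S_n^T$. Assimilation: with the transform matrix given by the inverse of the symmetric positive definite square root, $$T(\widehat S)=\big(I_K+(K-1)^{-1}\widehat S^TH^TH\widehat S\big)^{-1/2},\qquad S_n=\widehat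 S_nT(\widehat S_n),$$ $$V_n^{(k)}=\overline{\widehat V}_n-\widehat C_nH^T(I+H\widehat C_nH^T)^{-1}(H\overline{\widehat V}_n-Z_n)+S_n^{(k)},$$ where $S_n^{(k)}$ is the $k$-th column of $S_n$. $X_n$ is a Markov chain on $\mathbb{R}^d\times\mathbb{R}^{d\times K}$; $\mathcal{F}_n=\sigma\{X_m:m\le n\}$ and $\mathbb{E}_n$ is conditional expectation given $\mathcal{F}_n$. Geometric ergodicity of $X_n$ means: there is a unique invariant probability measure $\pi$ and constants $r\in(0,1)$, $\kappa>0$ such that for every initial probability distribution $\mu$ and all $n\ge0$, $\|\mathbb{P}^\mu(X_n\in\cdot)-\pi\|_{TV}\le\kappa r^n\big(1+\int\mathcal{E}\,d\mu\big)$. In particular, for initial laws $\mu,\nu$ integrating $\mathcal{E}$ and $P$ the transition kernel, $\|P^n\mu-P^n\nu\|_{TV}\le C_{\mu,\nu}r^n$. *)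

(* Defs.v *)
(* Mathematical Components / MathComp-Analysis. *)
From HB Require Import structures.
From mathcomp Require Import all_boot all_order all_algebra.
From mathcomp Require Import all_classical all_reals all_analysis.
From mathcomp Require Import measurable_realfun.

Set Implicit Arguments.
Unset Strict Implicit.
Unset Printing Implicit Defensive.
Import Order.TTheory GRing.Theory Num.Theory.
Import numFieldNormedType.Exports.

Local Open Scope classical_set_scope.
Local Open Scope ring_scope.

(* Real matrices, in particular the column vectors of R^d, carry the Borel
   sigma-algebra of their topology.  On ['cV[R]_d * 'M[R]_(d, K)] the library's
   product sigma-algebra is then the Borel one as well. *)
Definition borel_mx_display : measure_display.
Proof. exact. Qed.

Section borel_matrix.
Context (R : realType) (m n : nat).

Let borel_mx : set (set 'M[R]_(m, n)) := <<s [set A | open A] >>.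

Let borel_mx0 : borel_mx set0.
Proof. exact: sigma_algebra0. Qed.

Let borel_mxC A : borel_mx A -> borel_mx (~` A).
Proof. exact: sigma_algebraC. Qed.

Let borel_mx_bigcup (F : (set 'M[R]_(m, n))^nat) :
  (forall i, borel_mx (F i)) -> borel_mx (\bigcup_i F i).
Proof. exact: sigma_algebra_bigcup. Qed.

HB.instance Definition _ := @isMeasurable.Build borel_mx_display
  'M[R]_(m, n) borel_mx borel_mx0 borel_mxC borel_mx_bigcup.

End borel_matrix.

Section euclidean_space.
Context (R : realType).

(* The norm [`|x|] of the library is the sup norm on matrices. *)
Definition enorm (p : nat) (x : 'cV[R]_p) : R :=
  Num.sqrt (\sum_(i < p) x i 0 ^+ 2).

(* p-dimensional Lebesgue measure, as the iterated product of the
   one-dimensional one: the measure of A is the integral over the first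
   coordinate x of the measure of the section of A at x. *)
Fixpoint lebesgue_cV (p : nat) : set 'cV[R]_p -> \bar R :=
  match p with
  | 0 => fun A => \d_(0 : 'cV[R]_0) A
  | p'.+1 => fun A =>
      (\int[@lebesgue_measure R]_x
         lebesgue_cV [set v : 'cV[R]_p' | A (col_mx x%:M v : 'cV[R]_p'.+1)])%E
  end.

Definition has_mean_cov (p : nat) (P : {measure set 'cV[R]_p -> \bar R})
    (m : 'cV[R]_p) (S : 'M[R]_p) : Prop :=
  [/\ forall i, P.-integrable setT (fun z : 'cV[R]_p => (z i 0 ^+ 2)%:E),
      forall i, (\int[P]_z (z i 0)%:E = (m i 0)%:E)%E &
      forall i j, (\int[P]_z ((z i 0 - m i 0) * (z j 0 - m j 0))%:E
                   = (S i j)%:E)%E].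

Definition sym_posdef (p : nat) (A : 'M[R]_p) : Prop :=
  A^T = A /\ forall x : 'cV[R]_p, x != 0 -> 0 < (x^T *m A *m x) 0 0.

(* The symmetric positive definite square root; 1 if there is none. *)
Definition spd_sqrt (p : nat) (A : 'M[R]_p) : 'M[R]_p :=
  xget 1%:M [set B | sym_posdef B /\ B *m B = A].

End euclidean_space.

(* An ensemble of K members of R^d is the d x K matrix of its columns. *)
Section etkf.
Context (R : realType) (q d K : nat).
Context (H : 'M[R]_(q, d)) (Psi : 'cV[R]_d -> 'cV[R]_d).

Definition ens_mean (V : 'M[R]_(d, K)) : 'cV[R]_d :=
  K%:R^-1 *: \sum_(k < K) col k V.

Definition ens_dev (V : 'M[R]_(d, K)) : 'M[R]_(d, K) :=
  \matrix_(i, k) (V i k - ens_mean V i 0).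

Definition ens_cov (V : 'M[R]_(d, K)) : 'M[R]_d :=
  (K%:R - 1)^-1 *: (ens_dev V *m (ens_dev V)^T).

Definition etkf_transform (S : 'M[R]_(d, K)) : 'M[R]_K :=
  invmx (spd_sqrt (1%:M + (K%:R - 1)^-1 *: (S^T *m H^T *m H *m S))).

Definition etkf_forecast (V zeta : 'M[R]_(d, K)) : 'M[R]_(d, K) :=
  \matrix_(i, k) (Psi (col k V) i 0 + zeta i k).

Definition etkf_assimilate (Vh : 'M[R]_(d, K)) (z : 'cV[R]_q) : 'M[R]_(d, K) :=
  let m := ens_mean Vh in
  let S := ens_dev Vh in
  let C := ens_cov Vh in
  let a := m - C *m H^T *m invmx (1%:M + H *m C *m H^T) *m (H *m m - z) in
  \matrix_(i, k) (a i 0 + (S *m etkf_transform S) i k).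

Context (T : Type).

(* Column k of [zetaV n] is the forecast noise of the k-th ensemble member.
   The values of Z, zeta, zetaV and xi at time 0 play no role. *)
Definition etkf_dynamics (U zeta : nat -> T -> 'cV[R]_d)
    (V zetaV : nat -> T -> 'M[R]_(d, K)) (Z xi : nat -> T -> 'cV[R]_q) : Prop :=
  forall n w,
    [/\ U n.+1 w = Psi (U n w) + zeta n.+1 w,
        Z n.+1 w = H *m U n.+1 w + xi n.+1 w &
        V n.+1 w = etkf_assimilate (etkf_forecast (V n w) (zetaV n.+1 w))
                                   (Z n.+1 w)].

(* The past up to time n: all states up to time n and all noises of the
   times 1, ..., n. *)
Definition etkf_past (U zeta : nat -> T -> 'cV[R]_d)
    (V zetaV : nat -> T -> 'M[R]_(d, K)) (xi : nat -> T -> 'cV[R]_q)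
    (n : nat) : set (set T) :=
  <<s \bigcup_(m in [set m | (m <= n)%N])
        (preimage_set_system setT (U m) measurable `|`
         preimage_set_system setT (V m) measurable)
      `|`
      \bigcup_(m in [set m | (0 < m <= n)%N])
        (preimage_set_system setT (zeta m) measurable `|`
         preimage_set_system setT (zetaV m) measurable `|`
         preimage_set_system setT (xi m) measurable) >>.

End etkf.

(* Under P, given the past up to time n, the noises of time n+1 are independent,
   with laws kap (U_n) for the signal, kap (V_n^(k)) for the k-th ensemble
   member, and eta for the observation.  This is the defining property of the
   conditional probability of
   {zeta_(n+1) \in B0, zeta_(n+1)^(k) \in B k for all k, xi_(n+1) \in C}. *)
Definition etkf_noise (R : realType) (q d K : nat)
    (kap : R.-pker 'cV[R]_d ~> 'cV[R]_d) (eta : probability 'cV[R]_q R)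
    (dO : measure_display) (Omega : measurableType dO)
    (P : probability Omega R)
    (U zeta : nat -> Omega -> 'cV[R]_d) (V zetaV : nat -> Omega -> 'M[R]_(d, K))
    (xi : nat -> Omega -> 'cV[R]_q) : Prop :=
  forall (n : nat) (A : set Omega) (B0 : set 'cV[R]_d)
      (B : 'I_K -> set 'cV[R]_d) (C : set 'cV[R]_q),
    etkf_past U zeta V zetaV xi n A ->
    measurable B0 -> (forall k, measurable (B k)) -> measurable C ->
    (P (A `&` [set w | [/\ B0 (zeta n.+1 w),
                           forall k, B k (col k (zetaV n.+1 w)) &
                           C (xi n.+1 w)]])
     = \int[P]_(w in A)
         (kap (U n w) B0 * (\prod_(k < K) kap (col k (V n w)) (B k))
          * eta C))%E.

Section markov_family.
Context (R : realType) (dS : measure_display) (S : measurableType dS).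
Context (dO : measure_display) (Omega : measurableType dO).

(* F_n = sigma(X_0, ..., X_n) *)
Definition natural_filtration (X : nat -> Omega -> S) (n : nat) :
    set (set Omega) :=
  <<s \bigcup_(m in [set m | (m <= n)%N])
        preimage_set_system setT (X m) measurable >>.

(* Y' is a version of the conditional expectation of the nonnegative random
   variable Y given the sigma-algebra G.  Neither needs to be integrable. *)
Definition is_cond_expectation (P : probability Omega R) (G : set (set Omega))
    (Y Y' : Omega -> \bar R) : Prop :=
  [/\ forall w, (0 <= Y' w)%E,
      preimage_set_system setT Y' measurable `<=` G &
      forall A, G A -> (\int[P]_(w in A) Y' w = \int[P]_(w in A) Y w)%E].

(* sup_A |mu A - nu A|, i.e. half of the total mass of |mu - nu|. *)
Definition tv_dist (mu nu : set S -> \bar R) : \bar R :=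
  ereal_sup [set `|mu A - nu A|%E | A in measurable].

(* [P mu] is the law of the chain X started from the initial distribution mu. *)
Definition invariant_law (P : probability S R -> probability Omega R)
    (X : nat -> Omega -> S) (pi : probability S R) : Prop :=
  forall A, measurable A -> pushforward (P pi) (X 1%N) A = pi A.

Definition geometrically_ergodic (P : probability S R -> probability Omega R)
    (X : nat -> Omega -> S) (E : S -> R) : Prop :=
  exists pi : probability S R,
    [/\ invariant_law P X pi,
        forall pi' : probability S R, invariant_law P X pi' ->
          forall A, measurable A -> pi' A = pi A &
        exists r kappa : R,
          [/\ 0 < r < 1, 0 < kappa &
              forall (mu : probability S R) (n : nat),
                (tv_dist (pushforward (P mu) (X n)) pi
                 <= (kappa * r ^+ n)%:E * (1 + \int[mu]_x (E x)%:E))%E]].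

End markov_family.

(* Main.v *)
(* The chain is geometrically ergodic by Harris' theorem: besides the drift of
   the Lyapunov function it suffices that on every sublevel set the transition
   kernel dominates a multiple of one fixed probability measure.  A sublevel set
   is bounded, so by the kinetic energy principle the deterministic forecasts
   stay in a ball and, the noise dominating Lebesgue measure on a larger ball,
   the law of the next signal and of each forecast dominates a multiple of the
   uniform law on one small cube.  These forecasts being independent, their
   joint law with the observation noise dominates a multiple of a product law,
   and the analysis step is merely a fixed measurable map applied to it: the
   image of the product law is the minorizing measure.

   Harris' theorem is proved after Hairer and Mattingly: the kernel contracts
   the oscillation of functions weighted by 2 + e * (E x + E y), for a suitable
   small weight e. *)
Require Import Defs.
From HB Require Import structures.
From mathcomp Require Import all_boot all_order all_algebra.
From mathcomp Require Import all_classical all_reals all_analysis.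
From mathcomp Require Import measurable_realfun giry perm.
From mathcomp Require Import ring lra.

Set Implicit Arguments.
Unset Strict Implicit.
Unset Printing Implicit Defensive.
Import Order.TTheory GRing.Theory Num.Theory.
Import numFieldNormedType.Exports.

Local Open Scope classical_set_scope.
Local Open Scope ring_scope.

(** * Harris' theorem *)

(** Measures are never compared in a metric space. The contraction is applied to the functions
    giving the [n]-step probability of a fixed set, and yields a limit [l A] at a rate uniform in
    [A] and weighted by [1 + E x] in the starting point. Uniformity in [A] turns [l] into a
    probability measure; the pointwise weighted bound, integrated against an initial law, is the
    claimed rate.

    The data contain no transition kernel, only one probability measure on [Omega] for each initial
    law, with nothing assumed on how they depend on that law. The kernel is the law at time 1
    started from a Dirac mass; its measurability in the starting point and the Markov property are
    both extracted from the condition on the noises.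

    Measurability of the analysis map is a real obstacle, because the transform contains a matrix
    square root specified only by its defining property. *)

Section integrals_against_probabilities.
Context (R : realType) (d : measure_display) (S : measurableType d).
Implicit Types (m : probability S R) (f g : S -> R).

Lemma integrable_unit_interval m f : measurable_fun setT f ->
  (forall x, 0 <= f x <= 1) -> m.-integrable setT (EFin \o f).
Proof.
move=> mf f01.
apply: (@le_integrable _ _ _ m setT measurableT (EFin \o f) (EFin \o cst 1)).
- exact/measurable_EFinP.
- move=> x _ /=; rewrite lee_fin normr1.
  by case/andP: (f01 x) => f0 f1; rewrite ger0_norm.
- exact: finite_measure_integrable_cst.
Qed.

Lemma integrable_ge0_le m f (r : R) : measurable_fun setT f ->
  (forall x, 0 <= f x) -> (\int[m]_x (f x)%:E <= r%:E)%E ->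
  m.-integrable setT (EFin \o f).
Proof.
move=> mf f0 fr; apply/integrableP; split; first exact/measurable_EFinP.
rewrite (eq_integral (fun x => (f x)%:E)); last first.
  by move=> x _; rewrite /= ger0_norm.
exact: le_lt_trans fr (ltry _).
Qed.

Lemma Rintegral_prob_cst m (r : R) : \int[m]_(x in setT) r = r.
Proof.
rewrite Rintegral_cst//.
rewrite (_ : fine _ = 1) ?mulr1//.
exact: (congr1 fine (probability_setT m)).
Qed.

Lemma minorized_integral m (nu : probability S R) (a : R) (g : S -> \bar R) :
  0 <= a -> (forall A, measurable A -> (a%:E * nu A <= m A)%E) ->
  measurable_fun setT g -> (forall x, 0 <= g x)%E ->
  (a%:E * \int[nu]_x g x <= \int[m]_x g x)%E.
Proof.
move=> a0 am mg g0.
rewrite -(@ge0_integral_mscale _ _ _ nu setT measurableT (NngNum a0))//=.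
exact: ge0_le_measure_integral.
Qed.

(** The minorizing law comes without any moment bound; its integrals are finite because [a * nu]
    lies below a law under which [g] is integrable. *)
Lemma minorized_integrable m (nu : probability S R) (a : R) g : 0 < a ->
  (forall A, measurable A -> (a%:E * nu A <= m A)%E) ->
  measurable_fun setT g -> (forall x, 0 <= g x) ->
  m.-integrable setT (EFin \o g) -> nu.-integrable setT (EFin \o g).
Proof.
move=> a0 am mg g0 ig.
have gfin : (\int[m]_x (g x)%:E)%E \is a fin_num by exact: integrable_fin_num.
apply: (@integrable_ge0_le _ _ (a^-1 * fine (\int[m]_x (g x)%:E)%E)) => //.
rewrite EFinM fineK// -lee_pdivrMl ?invr_gt0// invrK.
apply: minorized_integral => [||| x]; [exact: ltW|by []| |by rewrite lee_fin].
exact/measurable_EFinP.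
Qed.

Lemma minorized_Rintegral m (nu : probability S R) (a : R) g : 0 <= a ->
  (forall A, measurable A -> (a%:E * nu A <= m A)%E) ->
  measurable_fun setT g -> (forall x, 0 <= g x) ->
  m.-integrable setT (EFin \o g) -> nu.-integrable setT (EFin \o g) ->
  a * \int[nu]_(x in setT) g x <= \int[m]_(x in setT) g x.
Proof.
move=> a0 am mg g0 ig ig'.
rewrite -lee_fin EFinM /Rintegral !fineK; [|exact: integrable_fin_num..].
apply: minorized_integral => [||| x]; [by []|by []| |by rewrite lee_fin].
exact/measurable_EFinP.
Qed.

Lemma Rintegral_affine m f1 f2 (a b c : R) :
  m.-integrable setT (EFin \o f1) -> m.-integrable setT (EFin \o f2) ->
  \int[m]_(x in setT) (a * f1 x + b * f2 x + c) =
  a * \int[m]_(x in setT) f1 x + b * \int[m]_(x in setT) f2 x + c.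
Proof.
move=> i1 i2.
have ic : m.-integrable setT (EFin \o cst c).
  exact: finite_measure_integrable_cst.
have j1 : m.-integrable setT (EFin \o (fun x => a * f1 x)).
  by apply: eq_integrable (integrableZl measurableT a i1) => // x _ /=.
have j2 : m.-integrable setT (EFin \o (fun x => b * f2 x)).
  by apply: eq_integrable (integrableZl measurableT b i2) => // x _ /=.
have j12 : m.-integrable setT (EFin \o (fun x => a * f1 x + b * f2 x)).
  by apply: eq_integrable (integrableD measurableT j1 j2) => // x _ /=.
by rewrite RintegralD// RintegralD// !RintegralZl// Rintegral_prob_cst.
Qed.

Lemma integrable_affine m f1 f2 (a b c : R) :
  m.-integrable setT (EFin \o f1) -> m.-integrable setT (EFin \o f2) ->
  m.-integrable setT (EFin \o (fun x => a * f1 x + b * f2 x + c)).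
Proof.
move=> i1 i2.
have ic : m.-integrable setT (EFin \o cst c).
  exact: finite_measure_integrable_cst.
have := integrableD measurableT (integrableD measurableT
  (integrableZl measurableT a i1) (integrableZl measurableT b i2)) ic.
by apply: eq_integrable.
Qed.

(* Coupling along the common part [a * nu] of the two measures, without
   constructing the coupling: the inequality between the values of [f] is
   integrated first in [x], then in [y], against the residual measures. *)
Lemma minorized_oscillation m1 m2 (nu : probability S R) (a D e : R)
    (E f : S -> R) : 0 <= a < 1 -> 0 <= e -> 0 <= D ->
  (forall A, measurable A -> (a%:E * nu A <= m1 A)%E) ->
  (forall A, measurable A -> (a%:E * nu A <= m2 A)%E) ->
  measurable_fun setT E -> (forall x, 0 <= E x) ->
  m1.-integrable setT (EFin \o E) -> m2.-integrable setT (EFin \o E) ->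
  nu.-integrable setT (EFin \o E) ->
  measurable_fun setT f -> (forall x, 0 <= f x <= 1) ->
  (forall x y, f x - f y <= D * (2 + e * (E x + E y))) ->
  \int[m1]_(x in setT) f x - \int[m2]_(x in setT) f x <=
  D * (2 * (1 - a) +
       e * (\int[m1]_(x in setT) E x + \int[m2]_(x in setT) E x)).
Proof.
move=> /andP[a0 a1] e0 D0 m1a m2a mE E0 i1 i2 inu mf f01 fosc.
have fi m : m.-integrable setT (EFin \o f) by exact: integrable_unit_interval.
set E1 := \int[m1]_(x in setT) E x; set E2 := \int[m2]_(x in setT) E x.
set F1 := \int[m1]_(x in setT) f x; set F2 := \int[m2]_(x in setT) f x.
pose En := \int[nu]_(x in setT) E x; pose Fn := \int[nu]_(x in setT) f x.
have En0 : 0 <= En by exact: Rintegral_ge0.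
(* [L] collects the terms free of [y] once the inequality is integrated in [x] against the residual
   [m1 - a * nu], whose mass is [1 - a]. *)
pose L := F1 - a * Fn - D * e * (E1 - a * En) - 2 * D * (1 - a).
have mlin (u v w : R) : measurable_fun setT (fun x => u * f x + v * E x + w).
  by do !apply: measurable_funD => //; exact: measurable_funM.
have HL y : L <= (1 - a) * (f y + D * e * E y).
  pose c := D * (2 + e * E y) + f y.
  have : a * \int[nu]_(x in setT) (-1 * f x + (D * e) * E x + c)
      <= \int[m1]_(x in setT) (-1 * f x + (D * e) * E x + c).
    apply: minorized_Rintegral => //; [|exact: integrable_affine..].
    move=> x; have := fosc x y; rewrite /c; lra.
  rewrite !Rintegral_affine// -/E1 -/F1 -/En -/Fn /c /L; nra.
have : a * \int[nu]_(x in setT) ((1 - a) * f x + ((1 - a) * (D * e)) * E x - L)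
    <= \int[m2]_(x in setT) ((1 - a) * f x + ((1 - a) * (D * e)) * E x - L).
  apply: minorized_Rintegral => //; [|exact: integrable_affine..].
  move=> x; have := HL x; lra.
rewrite !Rintegral_affine// -/E2 -/F2 -/En -/Fn => H.
(* The residual [m2 - a * nu] also has mass [1 - a], so this factor splits off, and [a < 1] allows
   dividing by it. The remaining terms in [En] have a favourable sign and are dropped. *)
have {}H : (1 - a) * (F2 - a * Fn + D * e * (E2 - a * En) - L) >= 0 by nra.
rewrite pmulr_rge0 ?subr_gt0// in H.
have : 0 <= D * e * (a * En) by rewrite !mulr_ge0.
rewrite /L in H *; nra.
Qed.

End integrals_against_probabilities.

(** * Markov kernels acting on functions, and the weighted contraction *)

Section markov_kernels.
Context (R : realType) (d : measure_display) (S : measurableType d).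
Context (k : S -> probability S R).
Implicit Types (f : S -> R).
Context (mk : forall A, measurable A -> measurable_fun setT (fun x => k x A)).

Definition kernel_mean (f : S -> R) (x : S) : R := \int[k x]_(y in setT) f y.

Let kg (x : S) : giry S R := k x.

Let mkg : measurable_fun setT kg.
Proof. exact: measurable_giry_codensity. Qed.

Lemma measurable_integral_kernel (g : S -> \bar R) : measurable_fun setT g ->
  (forall x, 0 <= g x)%E -> measurable_fun setT (fun x => \int[k x]_y g y)%E.
Proof.
move=> mg g0.
exact: (measurableT_comp (measurable_giry_int mg g0) mkg).
Qed.

(** The law [m'] is the Giry bind of [m] along the kernel. *)
Lemma integral_mixture (m m' : probability S R) (g : S -> \bar R) :
  (forall A, measurable A -> m' A = \int[m]_x k x A)%E ->
  measurable_fun setT g -> (forall x, 0 <= g x)%E ->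
  (\int[m']_x g x = \int[m]_x \int[k x]_y g y)%E.
Proof.
move=> m'E mg g0; pose mg' : giry S R := m.
have := giry_int_bind mg' mkg mg g0.
rewrite /giry_int => <-.
apply: eq_measure_integral => A mA _.
apply: (eq_trans (m'E A mA)).
rewrite /giry_bind/= giry_int_map//.
exact: measurable_giry_ev.
Qed.

Lemma kernel_mean_unit_interval f : measurable_fun setT f ->
  (forall x, 0 <= f x <= 1) -> forall x, 0 <= kernel_mean f x <= 1.
Proof.
move=> mf f01 x; apply/andP; split.
  by apply: Rintegral_ge0 => y _; case/andP: (f01 y).
rewrite -[leRHS](Rintegral_prob_cst (k x)).
apply: le_Rintegral => //; first exact: integrable_unit_interval.
  exact: finite_measure_integrable_cst.
by move=> y _; case/andP: (f01 y).
Qed.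

Lemma EFin_kernel_mean f x : measurable_fun setT f ->
  (forall x, 0 <= f x <= 1) ->
  (kernel_mean f x)%:E = (\int[k x]_y (f y)%:E)%E.
Proof.
by move=> mf f01; rewrite fineK//; apply: integrable_fin_num => //;
  exact: integrable_unit_interval.
Qed.

Lemma measurable_kernel_mean f : measurable_fun setT f ->
  (forall x, 0 <= f x <= 1) -> measurable_fun setT (kernel_mean f).
Proof.
move=> mf f01; apply/measurable_EFinP.
apply: (eq_measurable_fun (fun x => \int[k x]_y (f y)%:E)%E).
  by move=> x _ /=; rewrite EFin_kernel_mean.
apply: measurable_integral_kernel; first exact/measurable_EFinP.
by move=> x; rewrite lee_fin; case/andP: (f01 x).
Qed.

Lemma Rintegral_mixture (m m' : probability S R) f :
  (forall A, measurable A -> m' A = \int[m]_x k x A)%E ->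
  measurable_fun setT f -> (forall x, 0 <= f x <= 1) ->
  \int[m']_(x in setT) f x = \int[m]_(x in setT) kernel_mean f x.
Proof.
move=> m'E mf f01; rewrite /Rintegral; congr fine.
under [RHS]eq_integral do rewrite EFin_kernel_mean//.
apply: integral_mixture => //; first exact/measurable_EFinP.
by move=> x; rewrite lee_fin; case/andP: (f01 x).
Qed.

(** This is the [n]-step transition probability into [A], as a function of the starting point. *)
Definition kernel_iter (A : set S) (n : nat) : S -> R :=
  iter n kernel_mean (\1_A).

Lemma kernel_iterP A n : measurable A ->
  measurable_fun setT (kernel_iter A n) /\
  (forall x, 0 <= kernel_iter A n x <= 1).
Proof.
move=> mA; elim: n => [|n [m01 i01]]; rewrite /kernel_iter/=.
  split; first exact: measurable_indic.
  by move=> x; rewrite indicE; case: (_ \in _); rewrite !lexx ler01.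
split; first exact: measurable_kernel_mean.
exact: kernel_mean_unit_interval.
Qed.

Lemma Rintegral_indicE (m : probability S R) A : measurable A ->
  \int[m]_(x in setT) (\1_A x : R) = fine (m A).
Proof. by move=> mA; rewrite /Rintegral integral_indic// setIT. Qed.

(** Each step taken by the law is moved onto the integrand, so the induction has to run over all
    measurable functions with values in [0, 1] and not only over indicators. *)
Lemma law_kernel_iter (law : nat -> probability S R) :
  (forall n A, measurable A -> law n.+1 A = \int[law n]_x k x A)%E ->
  forall n A, measurable A ->
    fine (law n A) = \int[law 0%N]_(x in setT) kernel_iter A n x.
Proof.
move=> lawS n A mA; rewrite -Rintegral_indicE//.
suff H f : measurable_fun setT f -> (forall x, 0 <= f x <= 1) ->
    \int[law n]_(x in setT) f x
    = \int[law 0%N]_(x in setT) iter n kernel_mean f x.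
  by case: (kernel_iterP 0 mA) => ? ?; apply: H.
elim: n f => [//|n IH] f mf f01.
rewrite (Rintegral_mixture (lawS n))// IH ?iterSr//.
  exact: measurable_kernel_mean.
exact: kernel_mean_unit_interval.
Qed.

Section drift.
Context (E : S -> R) (mE : measurable_fun setT E) (E0 : forall x, 0 <= E x).
Context (b c : R) (b01 : 0 < b < 1) (c0 : 0 < c).
Context (drift : forall x,
  (\int[k x]_y (E y)%:E <= ((1 - b) * E x + c)%:E)%E).

Lemma drift_integrable x : (k x).-integrable setT (EFin \o E).
Proof. exact: (integrable_ge0_le mE E0 (drift x)). Qed.

Lemma drift_kernel_mean x : kernel_mean E x <= (1 - b) * E x + c.
Proof.
rewrite -lee_fin /kernel_mean /Rintegral fineK; first exact: drift.
by apply: integrable_fin_num => //; exact: drift_integrable.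
Qed.

(** The constants [g] and [e] are fixed before [f] and [D], so the conclusion is the hypothesis for
    [kernel_mean k f] with [g * D] in place of [D], and can be iterated. *)
Lemma harris_contraction :
  (forall a : R, exists al : R, exists nu : probability S R,
     0 < al /\ (forall x, E x <= a -> forall A, measurable A ->
       (al%:E * nu A <= k x A)%E)) ->
  exists g e : R, [/\ 0 < g < 1, 0 < e &
    forall (f : S -> R) (D : R), measurable_fun setT f ->
      (forall x, 0 <= f x <= 1) -> 0 <= D ->
      (forall x y, f x - f y <= D * (2 + e * (E x + E y))) ->
      forall x y, kernel_mean f x - kernel_mean f y
                  <= g * D * (2 + e * (E x + E y))].
Proof.
case/andP: b01 => b0 b1 /(_ (4 * c / b)) [al' [nu [al'0 nuk']]].
pose al := Num.min al' 2^-1.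
have al0 : 0 < al by rewrite lt_min al'0 invr_gt0 ltr0n.
have al1 : al <= 2^-1 by rewrite ge_min lexx orbT.
have nuk x : E x <= 4 * c / b -> forall A, measurable A ->
    (al%:E * nu A <= k x A)%E.
  move=> xa A mA; apply: le_trans (nuk' x xa A mA).
  by rewrite lee_wpmul2r// lee_fin ge_min lexx.
have albE : 0 < al * b by exact: mulr_gt0.
(* With this weight, the additive constants of the drift at two points cost [2 * (e * c) = al], half
   of the [2 * al] gained by the minorization. *)
pose e := al / (2 * c).
have e0 : 0 < e by rewrite divr_gt0// mulr_gt0.
have ec : 2 * (e * c) = al by rewrite /e; field; rewrite gt_eqF.
have alb1 : al * b <= 2^-1.
  by rewrite -[leRHS]mulr1 ler_pM// ltW.
exists (1 - al * b / 4), e; split=> //; first by apply/andP; split; lra.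
move=> f D mf f01 D0 fosc x y.
have dx := drift_kernel_mean x; have dy := drift_kernel_mean y.
have Ex := E0 x; have Ey := E0 y.
have ix := drift_integrable x; have iy := drift_integrable y.
(* Below the level both points lie in the minorized sublevel set, since [E] is nonnegative. *)
have [S_lt|S_ge] := ltP (E x + E y) (4 * c / b).
- have := @minorized_oscillation _ _ _ (k x) (k y) nu al D e E f.
  move=> /(_ _ (ltW e0) D0 (nuk x _) (nuk y _) mE E0 ix iy _ mf f01 fosc).
  have al01 : 0 <= al < 1 by apply/andP; split; lra.
  have Exa : E x <= 4 * c / b by lra.
  have Eya : E y <= 4 * c / b by lra.
  have inu := minorized_integrable al0 (nuk x Exa) mE E0 ix.
  move=> /(_ al01 Exa Eya inu) /le_trans; apply.
  rewrite -mulrA mulrCA ler_wpM2l// -/(kernel_mean _ _) -/(kernel_mean _ _).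
  have : e * (kernel_mean E x + kernel_mean E y)
      <= e * ((1 - b) * (E x + E y) + 2 * c) by rewrite ler_pM2l//; lra.
  have -> : e * ((1 - b) * (E x + E y) + 2 * c)
      = (1 - b) * (e * (E x + E y)) + 2 * (e * c) by ring.
  have : 0 <= e * (E x + E y) by rewrite mulr_ge0 ?addr_ge0// ltW.
  set w := e * (E x + E y) => w0 w1.
  have bw : 0 <= b * w by rewrite mulr_ge0// ltW.
  have : al * (b * w) <= 2^-1 * (b * w) by rewrite ler_wpM2r.
  have : al * b <= al by rewrite ler_piMr// ltW.
  lra.
(* Above the level nothing is coupled (coefficient 0). The level [4 * c / b] makes the drift gain
   [b * (e * (E x + E y))] at least [2 * al], twice the cost of its additive constants. *)
- have k0 z : forall A, measurable A -> (0%:E * k x A <= k z A)%E.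
    by move=> A _; rewrite mul0e.
  have := @minorized_oscillation _ _ _ (k x) (k y) (k x) 0 D e E f.
  move=> /(_ _ (ltW e0) D0 (k0 x) (k0 y) mE E0 ix iy ix mf f01 fosc).
  have z1 : 0 <= (0 : R) < 1 by rewrite lexx ltr01.
  move=> /(_ z1) /le_trans; apply.
  rewrite -mulrA mulrCA ler_wpM2l// -/(kernel_mean _ _) -/(kernel_mean _ _).
  have : e * (kernel_mean E x + kernel_mean E y)
      <= e * ((1 - b) * (E x + E y) + 2 * c) by rewrite ler_pM2l//; lra.
  have -> : e * ((1 - b) * (E x + E y) + 2 * c)
      = (1 - b) * (e * (E x + E y)) + 2 * (e * c) by ring.
  have : 2 * al <= b * (e * (E x + E y)).
    have -> : 2 * al = b * (e * (4 * c / b)).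
      by rewrite -ec; field; rewrite gt_eqF.
    by rewrite !ler_pM2l.
  set w := e * (E x + E y) => w1 w2.
  have wb : 0 <= b * w by lra.
  have : al * (b * w) <= 2^-1 * (b * w) by rewrite ler_wpM2r.
  have : b * (2 * al) <= 1 * (b * w).
    by rewrite ler_pM// ?ltW//; lra.
  lra.
Qed.

End drift.
End markov_kernels.

(** * Setwise limits of probability measures at a uniform rate *)

Section uniform_limits.
Context (R : realType) (d : measure_display) (S : measurableType d).

Lemma le_of_vanishing (e : R^nat) (x y : R) : e @ \oo --> (0 : R) ->
  (forall n, x <= y + e n) -> x <= y.
Proof.
move=> e0 xy.
have ye : (fun n => y + e n) @ \oo --> y + 0.
  by apply: cvgD => //; exact: cvg_cst.
rewrite -[y]addr0 -(cvg_lim _ ye)//.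
by apply: limr_ge; [exact: cvgP ye|exact: nearW].
Qed.

(** Nested intervals: for [C = B / (1 - g)], the sum of the geometric series, [u n - C * g ^+ n]
    increases and [u n + C * g ^+ n] decreases; the limit is the supremum of the former. *)
Lemma geometric_increments_bound (u : R^nat) (B g : R) : 0 < g < 1 -> 0 <= B ->
  (forall n, `|u n.+1 - u n| <= B * g ^+ n) ->
  exists l : R, forall n, `|u n - l| <= B / (1 - g) * g ^+ n.
Proof.
case/andP=> g0 g1 B0 uB; set C := B / (1 - g).
have g1' : 1 - g != 0 by rewrite subr_eq0 gt_eqF.
have CB n : C * g ^+ n - C * g ^+ n.+1 = B * g ^+ n.
  by rewrite exprS /C; field.
pose a n := u n - C * g ^+ n; pose b n := u n + C * g ^+ n.
have C0 n : 0 <= C * g ^+ n.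
  by rewrite mulr_ge0// ?exprn_ge0 ?divr_ge0 ?subr_ge0// ltW.
have aS n : a n <= a n.+1.
  by have := uB n; rewrite ler_norml /a => /andP[+ _]; have := CB n; lra.
have bS n : b n.+1 <= b n.
  by have := uB n; rewrite ler_norml /b => /andP[_ +]; have := CB n; lra.
have ab n m : a n <= b m.
  have amono i j : (i <= j)%N -> a i <= a j
    by move=> ij; exact: (proj1 (nondecreasing_seqP a) aS).
  have bmono i j : (i <= j)%N -> b j <= b i
    by move=> ij; exact: (proj1 (nonincreasing_seqP b) bS).
  apply: le_trans (amono n _ (leq_maxl n m)) _.
  apply: le_trans _ (bmono m _ (leq_maxr n m)).
  by rewrite /a /b; have := C0 (maxn n m); lra.
have hs : has_sup (range a).
  by split; [exists (a 0%N), 0%N|exists (b 0%N) => _ [n _ <-]].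
exists (sup (range a)) => n; rewrite ler_norml; apply/andP; split.
- have : sup (range a) <= b n by apply: ge_sup => [|_ [m _ <-]//]; case: hs.
  by rewrite /b; lra.
- have : a n <= sup (range a).
    by apply: ub_le_sup; [case: hs|exists n].
  by rewrite /a; lra.
Qed.

Section limit.
Context (m : nat -> probability S R) (l : set S -> R) (e : R^nat).
Context (e0 : e @ \oo --> (0 : R)).
Context (ml : forall n A, measurable A -> `|fine (m n A) - l A| <= e n).

Let eM (c : R) : (fun n => c * e n) @ \oo --> (0 : R).
Proof.
by rewrite -[X in _ --> X](mulr0 c); apply: cvgM => //; exact: cvg_cst.
Qed.

Let mfin n A : measurable A -> m n A \is a fin_num.
Proof. exact: fin_num_measure. Qed.

Let ml_le n A : measurable A -> fine (m n A) <= l A + e n.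
Proof. by move=> mA; have := ml n mA; rewrite ler_norml => /andP[_]; lra. Qed.

Let ml_ge n A : measurable A -> l A <= fine (m n A) + e n.
Proof. by move=> mA; have := ml n mA; rewrite ler_norml => /andP[+ _]; lra. Qed.

Let l_ge0 A : measurable A -> 0 <= l A.
Proof.
move=> mA; apply: (le_of_vanishing e0) => n.
by apply: le_trans (ml_le n mA); exact: fine_ge0.
Qed.

Let lim_unique A (x : R) : measurable A -> (forall n, fine (m n A) = x) ->
  l A = x.
Proof.
move=> mA mx; apply/eqP; rewrite eq_le; apply/andP; split;
  apply: (le_of_vanishing e0) => n; rewrite -(mx n).
  exact: ml_ge.
exact: ml_le.
Qed.

Let l0 : l set0 = 0.
Proof. by apply: lim_unique => // n; rewrite measure0. Qed.

Let lU A B : measurable A -> measurable B -> [disjoint A & B] ->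
  l (A `|` B) = l A + l B.
Proof.
move=> mA mB AB.
have mAB n : fine (m n (A `|` B)) = fine (m n A) + fine (m n B).
  rewrite measureU//; last exact/disj_set2P.
  by rewrite fineD// mfin.
have mU : measurable (A `|` B) by exact: measurableU.
apply/eqP; rewrite eq_le; apply/andP; split;
  apply: (le_of_vanishing (eM 3)) => n; have := mAB n;
  have := ml_le n mA; have := ml_le n mB; have := ml_ge n mA;
  have := ml_ge n mB; have := ml_le n mU; have := ml_ge n mU; lra.
Qed.

(** Nothing is known of [l] outside the measurable sets; the value 0 there keeps [p] nonnegative
    everywhere. *)
Let p (A : set S) : \bar R := (if `[< measurable A >] then l A else 0)%:E.

Let pE A : measurable A -> p A = (l A)%:E.
Proof. by move=> mA; rewrite /p asboolT. Qed.

Let p0 : p set0 = 0%E.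
Proof. by rewrite pE// l0. Qed.

Let p_ge0 A : (0 <= p A)%E.
Proof. by rewrite lee_fin; case: ifPn => // /asboolP/l_ge0. Qed.

(** The error [e N] is the same for all sets, so one [N] controls the union and all partial unions
    at once, and countable additivity of the single measure [m N] does the rest. *)
Let p_sigma_additive : semi_sigma_additive p.
Proof.
move=> F mF tF mUF; rewrite pE//.
have -> : (fun n => \sum_(0 <= i < n) p (F i))%E
    = EFin \o (fun n => \sum_(0 <= i < n) l (F i)).
  apply/funext => n /=; rewrite -sumEFin.
  by apply: eq_bigr => i _; rewrite pE.
have mU n : measurable (\big[setU/set0]_(0 <= i < n) F i).
  by apply: bigsetU_measurable.
have lsum n : \sum_(0 <= i < n) l (F i) = l (\big[setU/set0]_(0 <= i < n) F i).
  elim: n => [|n IH]; first by rewrite !big_geq// l0.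
  rewrite !big_nat_recr//= IH lU//.
  apply/disj_set2P; rewrite big_mkord.
  by apply: (@trivIset_bigsetUI _ predT) => //; rewrite /predT /= trueE.
have msum k n : fine (m k (\big[setU/set0]_(0 <= i < n) F i))
    = \sum_(0 <= i < n) fine (m k (F i)).
  by rewrite big_mkord measure_bigsetU// [RHS]sum_fine ?big_mkord// => i _;
    exact: mfin.
apply: cvg_EFin; first exact: nearW.
apply/cvgrPdist_le => /= r r0.
have [N _ /(_ N (leqnn N)) eN] : \forall n \near \oo, `|0 - 3 * e n| <= r / 2.
  by move/cvgrPdist_le : (eM 3); apply; rewrite divr_gt0.
rewrite sub0r normrN ler_norml in eN.
have : (fun n => \sum_(0 <= i < n) fine (m N (F i))) @ \oo
    --> fine (m N (\bigcup_n F n)).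
  have : (fun n => \sum_(0 <= i < n) m N (F i))%E @ \oo
      --> (fine (m N (\bigcup_n F n)))%:E.
    by rewrite fineK ?mfin//; exact: measure_semi_sigma_additive.
  move/fine_cvgP => [_]; apply: cvg_trans; apply: near_eq_cvg; apply: nearW => n /=.
  by rewrite sum_fine// => i _; exact: mfin.
move/cvgrPdist_le => /(_ (r / 2)); rewrite divr_gt0// => /(_ isT).
apply: filterS => n; rewrite lsum -msum.
have := ml_le N (mU n); have := ml_ge N (mU n).
have := ml_le N mUF; have := ml_ge N mUF.
rewrite !ler_norml => ? ? ? ? /andP[? ?]; case/andP: eN => ? ?.
by apply/andP; split; lra.
Qed.

HB.instance Definition _ := isMeasure.Build _ _ _ p p0 p_ge0 p_sigma_additive.

Let pT : p setT = 1%E.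
Proof.
rewrite pE//; congr EFin; apply: lim_unique => // n.
exact: (congr1 fine (probability_setT (m n))).
Qed.

HB.instance Definition _ := Measure_isProbability.Build _ _ _ p pT.

Lemma uniform_limit_probability :
  exists pi : probability S R, forall A, measurable A -> pi A = (l A)%:E.
Proof. by exists p. Qed.

End limit.
End uniform_limits.

(** * Convergence of the iterates and the invariant law *)

Section harris_theorem.
Import HBNNSimple.
Context (R : realType) (d : measure_display) (S : measurableType d).
Context (k : S -> probability S R).
Context (mk : forall A, measurable A -> measurable_fun setT (fun x => k x A)).
Context (law : probability S R -> nat -> probability S R).
Context (law0 : forall mu A, measurable A -> law mu 0%N A = mu A).
Context (lawS : forall mu n A, measurable A ->
  (law mu n.+1 A = \int[law mu n]_x k x A)%E).

Lemma law_iter mu n A : measurable A ->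
  fine (law mu n A) = \int[mu]_(x in setT) kernel_iter k A n x.
Proof.
move=> mA; rewrite (law_kernel_iter mk (lawS mu))//.
congr fine; apply: eq_measure_integral => B mB _; exact: law0.
Qed.

Lemma law_dirac_iter x n A : measurable A ->
  fine (law (\d_x : probability S R) n A) = kernel_iter k A n x.
Proof.
move=> mA; rewrite law_iter//.
case: (kernel_iterP mk n mA) => mf _.
have mf' : measurable_fun setT (EFin \o kernel_iter k A n).
  exact/measurable_EFinP.
rewrite /Rintegral (integral_dirac x measurableT mf') diracT mul1e.
by [].
Qed.

Lemma invariant_kernel_iter (pi : probability S R) n A :
  (forall A, measurable A -> \int[pi]_x k x A = pi A)%E -> measurable A ->
  \int[pi]_(x in setT) kernel_iter k A n x = fine (pi A).
Proof.
move=> piP mA.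
have := law_kernel_iter mk (law := fun=> pi).
by move=> /(_ (fun n A mA => esym (piP A mA)) n A mA) <-.
Qed.

(** A nonnegative simple function has finitely many values, so a setwise error changes its integral
    by at most the sum of these values times the error. This replaces any continuity of the kernel
    when invariance is passed to the limit. *)
Lemma simple_integral_lim (m : nat -> probability S R) (pi : probability S R)
    (e : R^nat) (g : {nnsfun S >-> R}) (l : R) : e @ \oo --> (0 : R) ->
  (forall n A, measurable A -> (pi A <= m n A + (e n)%:E)%E) ->
  (forall n, (\int[m n]_x (g x)%:E <= (l + e n)%:E)%E) ->
  (\int[pi]_x (g x)%:E <= l%:E)%E.
Proof.
move=> e0 pim gl.
pose C : R := \sum_(r \in range g) r.
have gr0 r : range g r -> 0 <= r by case=> x _ <-; exact: fun_ge0.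
have C0 : 0 <= C by apply: fsumr_ge0 => r; exact: gr0.
have fR : finite_set (range g) by exact: fimfunP.
pose s := finmap.enum_fset (fset_set (range g)).
have mg r : measurable (g @^-1` [set r]) by exact: measurable_sfunP.
have intE (mu : probability S R) : (\int[mu]_x (g x)%:E =
    (\sum_(r <- s) r * fine (mu (g @^-1` [set r])))%:E)%E.
  rewrite integralT_nnsfun sintegralE fsbig_finite// -sumEFin.
  by apply: eq_bigr => r _; rewrite EFinM fineK// fin_num_measure.
rewrite intE lee_fin.
have Ce : (fun n => (C + 1) * e n) @ \oo --> (0 : R).
  by rewrite -[X in _ --> X](mulr0 (C + 1)); apply: cvgM => //; exact: cvg_cst.
apply: (le_of_vanishing Ce) => n.
have := gl n; rewrite intE lee_fin => gln.
have Cn : C * e n = \sum_(r <- s) r * e n.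
  by rewrite -mulr_suml /C fsbig_finite.
suff : \sum_(r <- s) r * fine (pi (g @^-1` [set r])) <=
    \sum_(r <- s) r * fine (m n (g @^-1` [set r])) + C * e n.
  lra.
rewrite Cn -big_split/= big_seq [leRHS]big_seq; apply: ler_sum => r.
rewrite in_fset_set// inE => /gr0 r0; rewrite -mulrDr ler_wpM2l//.
have := pim n _ (mg r).
rewrite -(fineK (fin_num_measure pi _ (mg r))).
by rewrite -(fineK (fin_num_measure (m n) _ (mg r))) lee_fin.
Qed.


Context (E : S -> R) (mE : measurable_fun setT E) (E0 : forall x, 0 <= E x).
Context (b c : R) (b01 : 0 < b < 1) (c0 : 0 < c).
Context (drift : forall x,
  (\int[k x]_y (E y)%:E <= ((1 - b) * E x + c)%:E)%E).
Context (minor : forall a : R, exists al : R, exists nu : probability S R,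
  0 < al /\ (forall x, E x <= a -> forall A, measurable A ->
    (al%:E * nu A <= k x A)%E)).

(** The oscillation of the [n]-step probability decays like [g ^+ n]. Averaged against [k x] it
    bounds the increment from [n] to [n.+1], which gives a limit at [x0]; the oscillation bound
    carries this limit to every other point. *)
Lemma harris_pointwise (x0 : S) : exists l : set S -> R, exists r kappa : R,
  [/\ 0 < r < 1, 0 < kappa &
   forall A, measurable A -> forall n x,
     `|kernel_iter k A n x - l A| <= kappa * r ^+ n * (1 + E x)].
Proof.
have [g [e [g01 e0 contr]]] :=
  harris_contraction mE E0 b01 c0 drift minor.
case/andP: (g01) => g0 g1; case/andP: (b01) => b0 b1.
have osc A n : measurable A -> forall x y,
    kernel_iter k A n x - kernel_iter k A n y
    <= g ^+ n * (2 + e * (E x + E y)).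
  move=> mA; elim: n => [|n IH] x y.
    have [_ i01] := kernel_iterP mk 0 mA.
    have /andP[_ x1] := i01 x; have /andP[y0 _] := i01 y.
    have : 0 <= e * (E x + E y) by rewrite mulr_ge0 ?addr_ge0// ltW.
    by rewrite expr0 mul1r; lra.
  have [mf i01] := kernel_iterP mk n mA.
  by rewrite exprS; apply: contr => //; rewrite exprn_ge0// ltW.
(* Integrating the weight in its second point and using the drift gives
   [2 + e * E x + e * (E x + c)], which is at most [C * (1 + E x)]. *)
pose C := 2 + 2 * e + e * c.
have C0 : 0 <= C by rewrite !addr_ge0 ?mulr_ge0// ltW.
have gn0 n : 0 <= g ^+ n by rewrite exprn_ge0// ltW.
have incr A n x : measurable A ->
    `|kernel_iter k A n.+1 x - kernel_iter k A n x|
    <= (C * (1 + E x)) * g ^+ n.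
  move=> mA; have [mf i01] := kernel_iterP mk n mA.
  have ix := drift_integrable mE E0 drift x.
  have dx : kernel_mean k E x <= E x + c.
    apply: le_trans (drift_kernel_mean mE E0 drift x) _.
    by have := E0 x; nra.
  have if_ := integrable_unit_interval (k x) mf i01.
  have Ex := E0 x.
  have iE : (k x).-integrable setT (EFin \o (fun y =>
      0 * kernel_iter k A n y + (g ^+ n * e) * E y +
      (g ^+ n * (2 + e * E x) + kernel_iter k A n x))).
    exact: integrable_affine.
  (* The values [s = -1] and [s = 1] give the two one-sided bounds on the increment. *)
  have ifm s : (k x).-integrable setT (EFin \o (fun y =>
      s * kernel_iter k A n y + 0 * E y + (1 - s) * kernel_iter k A n x)).
    exact: integrable_affine.
  have H : g ^+ n * (2 + e * E x) + g ^+ n * e * kernel_mean k E x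
      <= C * (1 + E x) * g ^+ n.
    have : g ^+ n * e * kernel_mean k E x <= g ^+ n * e * (E x + c).
      by rewrite ler_wpM2l// mulr_ge0// ltW.
    have : 0 <= g ^+ n * (2 * e + E x * (2 + e * c)).
      have ? := ltW e0; have ? := ltW c0.
      by rewrite mulr_ge0// addr_ge0 ?mulr_ge0// addr_ge0// mulr_ge0.
    by rewrite /C; lra.
  have int s := Rintegral_affine s 0 ((1 - s) * kernel_iter k A n x) if_ ix.
  have := Rintegral_affine 0 (g ^+ n * e)
    (g ^+ n * (2 + e * E x) + kernel_iter k A n x) if_ ix.
  rewrite -/(kernel_mean k E x) => intE.
  rewrite ler_norml; apply/andP; split.
  - have := le_Rintegral measurableT (ifm (-1)) iE.
    rewrite intE int -/(kernel_mean k E x) -/(kernel_mean k _ x).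
    rewrite -[kernel_mean k _ _]/(kernel_iter k A n.+1 x).
    have G y : setT y -> -1 * kernel_iter k A n y + 0 * E y +
        (1 - -1) * kernel_iter k A n x <= 0 * kernel_iter k A n y +
        g ^+ n * e * E y + (g ^+ n * (2 + e * E x) + kernel_iter k A n x).
      by move=> _; have := osc A n mA x y; lra.
    by move=> /(_ G); lra.
  - have := le_Rintegral measurableT (ifm 1) iE.
    rewrite intE int -/(kernel_mean k E x) -/(kernel_mean k _ x).
    rewrite -[kernel_mean k (kernel_iter _ _ _) _]/(kernel_iter k A n.+1 x).
    have G y : setT y -> 1 * kernel_iter k A n y + 0 * E y +
        (1 - 1) * kernel_iter k A n x <= 0 * kernel_iter k A n y +
        g ^+ n * e * E y + (g ^+ n * (2 + e * E x) + kernel_iter k A n x).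
      by move=> _; have := osc A n mA y x; lra.
    by move=> /(_ G); lra.
pose B := C * (1 + E x0).
have B0 : 0 <= B by rewrite mulr_ge0// addr_ge0.
have lim A : exists l : R, measurable A ->
    forall n, `|kernel_iter k A n x0 - l| <= B / (1 - g) * g ^+ n.
  have [mA|nmA] := pselect (measurable A); last by exists 0.
  have [l Hl] := geometric_increments_bound g01 B0 (fun n => incr A n x0 mA).
  by exists l.
(* In the constant, [2 + e + e * E x0] accounts for the oscillation between [x] and [x0], and the
   last term for the distance to the limit at [x0]. *)
exists (fun A => projT1 (cid (lim A))), g, (2 + e + e * E x0 + B / (1 - g)).
have D0 : 0 <= B / (1 - g) by rewrite divr_ge0// subr_ge0 ltW.
split=> //.
  have : 0 <= e * E x0 by rewrite mulr_ge0// ltW.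
  by lra.
move=> A mA n x; case: (cid (lim A)) => l /= /(_ mA n).
have Ex := E0 x; have Ex0 := E0 x0.
have H : g ^+ n * (2 + e * (E x + E x0)) + B / (1 - g) * g ^+ n
    <= (2 + e + e * E x0 + B / (1 - g)) * g ^+ n * (1 + E x).
  have : 0 <= g ^+ n * (e + (2 + e * E x0 + B / (1 - g)) * E x).
    have ? := ltW e0.
    by rewrite mulr_ge0// addr_ge0// mulr_ge0// !addr_ge0// mulr_ge0.
  by lra.
have := osc A n mA x x0; have := osc A n mA x0 x.
rewrite (addrC (E x0)).
by rewrite !ler_norml => ? ? /andP[? ?]; apply/andP; split; lra.
Qed.


Lemma geometric_vanishing (r a : R) : 0 < r < 1 ->
  (fun n => a * r ^+ n) @ \oo --> (0 : R).
Proof.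
move=> /andP[r0 r1]; rewrite -[X in _ --> X](mulr0 a); apply: cvgM.
  exact: cvg_cst.
by apply: cvg_expr; rewrite ger0_norm// ltW.
Qed.

Theorem harris (x0 : S) : exists pi : probability S R,
  [/\ forall A, measurable A -> (\int[pi]_x k x A = pi A)%E,
      forall pi' : probability S R,
        (forall A, measurable A -> (\int[pi']_x k x A = pi' A)%E) ->
        forall A, measurable A -> pi' A = pi A &
      exists r kappa : R, [/\ 0 < r < 1, 0 < kappa &
        forall (mu : probability S R) n A, measurable A ->
          (`|law mu n A - pi A|
           <= (kappa * r ^+ n)%:E * (1 + \int[mu]_x (E x)%:E))%E]].
Proof.
have [l [r [kappa [r01 kappa0 kl]]]] := harris_pointwise x0.
case/andP: (r01) => r0 r1.
pose m n := law (\d_x0 : probability S R) n.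
pose e n := kappa * (1 + E x0) * r ^+ n.
have e0 : e @ \oo --> (0 : R) by exact: geometric_vanishing.
have ml n A : measurable A -> `|fine (m n A) - l A| <= e n.
  by move=> mA; rewrite law_dirac_iter// /e mulrAC; exact: kl.
have [pi piE] := uniform_limit_probability e0 ml.
exists pi.
have mfin n A : measurable A -> m n A = (fine (m n A))%:E.
  by move=> mA; rewrite fineK// fin_num_measure.
have pi_le n A : measurable A -> (pi A <= m n A + (e n)%:E)%E.
  move=> mA; rewrite piE// mfin// lee_fin.
  by have := ml n A mA; rewrite ler_norml => /andP[+ _]; lra.
(* Approximating [x => k x A] from below by simple functions yields only an inequality; applied to
   the complement of [A] as well, it becomes an equality because the total masses agree. *)
have pik_le A : measurable A -> (\int[pi]_x k x A <= pi A)%E.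
  move=> mA; rewrite ge0_integralE; last by move=> x _; exact: measure_ge0.
  apply: ge_ereal_sup => _ [g gk <-]; rewrite -integralT_nnsfun.
  rewrite piE//.
  pose e' n := e n + e n.+1.
  have e'0 : e' @ \oo --> (0 : R).
    rewrite -[X in _ --> X](addr0 0); apply: cvgD => //.
    by rewrite (cvg_shiftS e).
  apply: (simple_integral_lim (m := m) e'0) => n.
    move=> B mB; apply: le_trans (pi_le n B mB) _.
    rewrite leeD2l// lee_fin lerDl /e.
    by rewrite /e !mulr_ge0 ?addr_ge0 ?exprn_ge0 // ltW.
  apply: (@le_trans _ _ (\int[m n]_x k x A)%E).
    apply: ge0_le_integral => //.
    - by move=> x _; rewrite lee_fin.
    - exact/measurable_EFinP.
    - exact: mk.
    - by move=> x _; have := gk x; rewrite patchE in_setT.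
  rewrite -lawS// -/(m n.+1) mfin// lee_fin.
  have := ml n.+1 A mA; rewrite ler_norml => /andP[_].
  have : 0 <= e n.
    by rewrite /e !mulr_ge0 ?addr_ge0 ?exprn_ge0 // ltW.
  by rewrite /e'; lra.
split.
- move=> A mA; apply/eqP; rewrite eq_le pik_le//=.
  have kfin x B : measurable B -> k x B \is a fin_num.
    by move=> mB; exact: fin_num_measure.
  have kB : (\int[pi]_x k x (~` A) = 1 - \int[pi]_x k x A)%E.
    have : (\int[pi]_x (k x (~` A) + k x A) = 1)%E.
      rewrite (eq_integral (cst 1%E)); last first.
        move=> x _ /=; rewrite -[RHS](probability_setT (k x)).
        rewrite -(setvU A) measureU ?setICl//; exact: measurableC.
      by rewrite integral_cst// mul1e; exact: (probability_setT pi).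
    rewrite ge0_integralD//.
    - move=> <-; rewrite addeK// ge0_fin_numE ?integral_ge0//.
      by apply: le_lt_trans (pik_le A mA) _; rewrite ltey_eq fin_num_measure.
    - exact/mk/measurableC.
    - exact: mk.
  have := pik_le _ (measurableC mA).
  rewrite kB probability_setC//.
  have fA : pi A \is a fin_num by exact: fin_num_measure.
  have fk : (\int[pi]_x k x A)%E \is a fin_num.
    rewrite ge0_fin_numE ?integral_ge0//.
    by apply: le_lt_trans (pik_le A mA) _; rewrite ltey_eq fA.
  rewrite -(fineK fA) -(fineK fk) -!EFinB !lee_fin; lra.
- move=> pi' piP A mA.
  have [mf f01] : (forall n, measurable_fun setT (kernel_iter k A n)) /\
      (forall n x, 0 <= kernel_iter k A n x <= 1).
    by split=> n; case: (kernel_iterP mk n mA).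
  (* The integral of the [n]-step probability under [pi'] is [pi' A] for all [n], while the
     integrand tends to [l A] and stays below 1. This also covers invariant laws under which [E]
     might have infinite integral. *)
  have := @dominated_convergence _ _ _ pi' setT measurableT
    (fun n => EFin \o kernel_iter k A n) (cst (l A)%:E) (cst 1%E).
  case.
  + by move=> n; exact/measurable_EFinP.
  + exact: measurable_cst.
  + apply: aeW => x _; apply: cvg_EFin; first exact: nearW.
    apply/cvgrPdist_le => /= t t0.
    have /cvgrPdist_le/(_ t t0) :=
      @geometric_vanishing r (kappa * (1 + E x)) r01.
    apply: filterS => n; rewrite sub0r normrN => H.
    rewrite distrC; apply: le_trans (kl A mA n x) (le_trans _ H).
    by rewrite mulrAC ler_norm.
  + exact: finite_measure_integrable_cst.
  + apply: aeW => x n _ /=; rewrite lee_fin.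
    by case/andP: (f01 n x) => *; rewrite ger0_norm.
  move=> _ _; rewrite integral_cst//.
  rewrite [X in (_ * X)%E](probability_setT pi') mule1.
  have -> : [sequence \int[pi']_x (EFin \o kernel_iter k A n) x]_n%E
      = cst (pi' A).
    apply/funext => n /=.
    rewrite -(fineK (fin_num_measure pi' _ mA)).
    rewrite -(invariant_kernel_iter n piP mA) /Rintegral fineK//.
    by apply: integrable_fin_num => //; exact: integrable_unit_interval.
  by move=> H; rewrite piE// -(cvg_lim _ H)// lim_cst.
- exists r, kappa; split=> // mu n A mA.
  have [mf f01] := kernel_iterP mk n mA.
  have kr0 : 0 < kappa * r ^+ n by rewrite mulr_gt0 ?exprn_gt0.
  have mfE : measurable_fun setT (EFin \o E) by exact/measurable_EFinP.
  have : (0 <= \int[mu]_x (E x)%:E)%E.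
    by apply: integral_ge0 => x _; rewrite lee_fin.
  (* If the integral of [E] is infinite, so is the bound, because [kappa * r ^+ n] is positive. *)
  case Ey : (\int[mu]_x (E x)%:E)%E => [s| |]// s0; last first.
    by rewrite addey// gt0_muley ?lte_fin// leey.
  have iE : mu.-integrable setT (EFin \o E).
    by apply: (@integrable_ge0_le _ _ _ _ _ s) => //; rewrite Ey.
  have if_ := integrable_unit_interval mu mf f01.
  have sE : \int[mu]_(x in setT) E x = s by rewrite /Rintegral Ey.
  rewrite piE// -(fineK (fin_num_measure (law mu n) _ mA)) -EFinB abse_EFin.
  rewrite -EFinD -EFinM lee_fin law_iter//.
  have i1 t : mu.-integrable setT (EFin \o (fun x =>
      t * kernel_iter k A n x + 0 * E x + - (t * l A))).
    exact: integrable_affine.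
  have i2 : mu.-integrable setT (EFin \o (fun x => 0 * kernel_iter k A n x +
      (kappa * r ^+ n) * E x + kappa * r ^+ n)).
    exact: integrable_affine.
  have H t : (t = 1) \/ (t = -1) ->
      t * (\int[mu]_(x in setT) kernel_iter k A n x - l A)
      <= kappa * r ^+ n * (1 + s).
    move=> tE; have := le_Rintegral measurableT (i1 t) i2.
    rewrite !Rintegral_affine// sE => G.
    have {}G := G _; apply: le_trans (le_trans (G _) _); [lra| |lra].
    move=> x _; have := kl A mA n x; rewrite ler_norml => /andP[? ?].
    by case: tE => ->; lra.
  by rewrite ler_norml; apply/andP; split; [have := H (-1) (or_intror erefl)|
    have := H 1 (or_introl erefl)]; lra.
Qed.

End harris_theorem.

(** * Borel measurability of matrix operations *)

Section borel_matrices.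
Context (R : realType).

Lemma open_measurable_mx m n (A : set 'M[R]_(m, n)) : open A -> measurable A.
Proof. exact: sub_gen_smallest. Qed.

Lemma closed_measurable_mx m n (A : set 'M[R]_(m, n)) :
  closed A -> measurable A.
Proof.
move=> cA; rewrite -(setCK A); apply: measurableC.
by apply: open_measurable_mx; exact: closed_openC.
Qed.

Lemma measurable_coord m n i j :
  measurable_fun setT (fun M : 'M[R]_(m, n) => M i j).
Proof.
apply: (measurability _ (RGenOInfty.measurableE R)) => //= _ [_ [a ->]] <-.
rewrite setTI; apply: open_measurable_mx.
have /continuousP := @coord_continuous R m n i j.
by apply; exact: interval_open.
Qed.

(** Countably many boxes forming a base of the topology: they reduce Borel measurability of a matrix
    to that of its entries. *)
Definition rational_box m n (c : 'M[rat]_(m, n) * nat) : set 'M[R]_(m, n) :=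
  [set M | forall i j, `|M i j - ratr (c.1 i j)| < c.2.+1%:R^-1].

Lemma rational_box_basis m n (x : 'M[R]_(m, n)) (A : set 'M[R]_(m, n)) :
  nbhs x A -> exists c, rational_box c x /\ rational_box c `<=` A.
Proof.
move=> /nbhs_ballP[e /= e0 xA].
(* Half of [e], because a box containing [x] has its centre within [w] of [x] and so reaches at most
   [2 * w] away from it. *)
have [N Ne] : exists N : nat, N.+1%:R^-1 < e / 2.
  have e20 : 0 < e / 2 by rewrite divr_gt0.
  have := near_infty_natSinv_lt (PosNum e20).
  by case=> N _ /(_ N (leqnn N)) /= H; exists N.
have [w [wE {}Ne Np]] : exists w : R, [/\ w = N.+1%:R^-1, w < e / 2 & 0 < w].
  by exists N.+1%:R^-1; rewrite invr_gt0.
have Q i j : exists r : rat, `|x i j - ratr r| < w.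
  have : x i j - w < x i j + w by lra.
  move=> /rat_in_itvoo[r]; rewrite in_itv/= => /andP[? ?].
  by exists r; rewrite ltr_norml; apply/andP; split; lra.
exists (\matrix_(i, j) projT1 (cid (Q i j)), N); rewrite /rational_box/= -wE.
split => [i j|y /= yb].
  by rewrite mxE; exact: projT2 (cid (Q i j)).
apply: xA; split => // i j; rewrite /ball/=.
have := yb i j; rewrite mxE; case: (cid _) => r /= xr yr.
by move: xr yr Ne; rewrite !ltr_norml => /andP[? ?] /andP[? ?] ?;
  apply/andP; split; lra.
Qed.

Lemma measurable_rational_box m n c : measurable (@rational_box m n c).
Proof.
have -> : rational_box c = \bigcap_(i in [set: 'I_m]) \bigcap_(j in [set: 'I_n])
    ((fun M : 'M[R]_(m, n) => M i j) @^-1`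
      ball (ratr (c.1 i j) : R) c.2.+1%:R^-1).
  apply/seteqP; split => [M H i _ j _|M H i j]; rewrite /= /ball/=.
    by rewrite distrC; exact: H.
  by rewrite distrC; exact: H.
apply: fin_bigcap_measurable => // i _; apply: fin_bigcap_measurable => // j _.
rewrite -[X in measurable X]setTI; apply: measurable_coord => //.
exact: measurable_ball.
Qed.

(** By second countability an open set is a countable union of rectangles. *)
Lemma open_measurable_mx_prod m n p q
    (A : set ('M[R]_(m, n) * 'M[R]_(p, q))%type) : open A -> measurable A.
Proof.
move=> oA.
pose I := (('M[rat]_(m, n) * nat) * ('M[rat]_(p, q) * nat))%type.
pose B (c : I) := rational_box c.1 `*` rational_box c.2 :
  set ('M[R]_(m, n) * 'M[R]_(p, q))%type.
have -> : A = \bigcup_(c in [set c | B c `<=` A]) B c.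
  apply/seteqP; split => [[x y] Axy|z [c cA]]; last exact: cA.
  have /= [[P Q] /= [xP yQ] PQA] := open_nbhs_nbhs (conj oA Axy).
  have [c [xc cP]] := rational_box_basis xP.
  have [c' [yc cQ]] := rational_box_basis yQ.
  exists (c, c') => //= -[u v] [/= uc vc]; apply: PQA.
  by split; [exact: cP|exact: cQ].
rewrite bigcup_mkcond; apply: countable_bigcupT_measurable => [|c].
  exact: countableP.
case: ifP => // _.
by apply: measurableX; exact: measurable_rational_box.
Qed.

Lemma measurable_fun_mx d (T : measurableType d) m n (f : T -> 'M[R]_(m, n)) :
  (forall i j, measurable_fun setT (fun t => f t i j)) -> measurable_fun setT f.
Proof.
move=> mf; apply: (measurability [set A : set 'M[R]_(m, n) | open A]) => //.
move=> _ [A oA <-]; rewrite setTI.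
have -> : A = \bigcup_(c in [set c | rational_box c `<=` A]) rational_box c.
  apply/seteqP; split => [x Ax|z [c cA]]; last exact: cA.
  have [c [xc cA]] := rational_box_basis (open_nbhs_nbhs (conj oA Ax)).
  by exists c.
rewrite preimage_bigcup bigcup_mkcond; apply: countable_bigcupT_measurable => [|c].
  exact: countableP.
case: ifP => // _.
have -> : f @^-1` rational_box c =
    \bigcap_(i in [set: 'I_m]) \bigcap_(j in [set: 'I_n])
    ((fun t => f t i j) @^-1` ball (ratr (c.1 i j) : R) c.2.+1%:R^-1).
  apply/seteqP; split => [M H i _ j _|M H i j]; rewrite /= /ball/=.
    by rewrite distrC; exact: H.
  by rewrite distrC; exact: H.
apply: fin_bigcap_measurable => // i _; apply: fin_bigcap_measurable => // j _.
rewrite -[X in measurable X]setTI; apply: mf => //.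
exact: measurable_ball.
Qed.

(** Compact sublevel sets are closed, so [E] is lower semicontinuous. The measurability of the
    Lyapunov function comes from here. *)
Lemma measurable_fun_compact_sublevels m n p q
    (E : ('M[R]_(m, n) * 'M[R]_(p, q))%type -> R) :
  (forall a, compact [set x | E x <= a]) -> measurable_fun setT E.
Proof.
move=> cE.
apply: (measurability _ (RGenOInfty.measurableE R)) => //= _ [_ [a ->]] <-.
rewrite setTI (_ : _ @^-1` _ = ~` [set x | E x <= a]); last first.
  apply/seteqP; split=> x /=; rewrite in_itv/= andbT ltNge.
    by move/negP.
  by move=> ?; apply/negP.
apply: open_measurable_mx_prod; apply: closed_openC.
by apply: compact_closed (cE a); exact: norm_hausdorff.
Qed.

Section operations.
Context d (T : measurableType d).

Lemma measurable_entry m n (f : T -> 'M[R]_(m, n)) i j :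
  measurable_fun setT f -> measurable_fun setT (fun t => f t i j).
Proof. exact: (measurableT_comp (measurable_coord i j)). Qed.

Lemma measurable_mulmx m n p (f : T -> 'M[R]_(m, n)) (g : T -> 'M[R]_(n, p)) :
  measurable_fun setT f -> measurable_fun setT g ->
  measurable_fun setT (fun t => f t *m g t).
Proof.
move=> mf mg; apply: measurable_fun_mx => i j.
under eq_fun do rewrite mxE.
apply: measurable_sum => k.
by apply: measurable_funM; exact: measurable_entry.
Qed.

Lemma measurable_addmx m n (f g : T -> 'M[R]_(m, n)) :
  measurable_fun setT f -> measurable_fun setT g ->
  measurable_fun setT (fun t => f t + g t).
Proof.
move=> mf mg; apply: measurable_fun_mx => i j.
under eq_fun do rewrite mxE.
by apply: measurable_funD; exact: measurable_entry.
Qed.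

Lemma measurable_scalemx m n (a : R) (f : T -> 'M[R]_(m, n)) :
  measurable_fun setT f -> measurable_fun setT (fun t => a *: f t).
Proof.
move=> mf; apply: measurable_fun_mx => i j.
under eq_fun do rewrite mxE.
by apply: measurable_funM => //; exact: measurable_entry.
Qed.

Lemma measurable_submx m n (f g : T -> 'M[R]_(m, n)) :
  measurable_fun setT f -> measurable_fun setT g ->
  measurable_fun setT (fun t => f t - g t).
Proof.
move=> mf mg; apply: measurable_addmx => //.
by under eq_fun do rewrite -scaleN1r; exact: measurable_scalemx.
Qed.

Lemma measurable_trmx m n (f : T -> 'M[R]_(m, n)) :
  measurable_fun setT f -> measurable_fun setT (fun t => (f t)^T).
Proof.
move=> mf; apply: measurable_fun_mx => i j.
by under eq_fun do rewrite mxE; exact: measurable_entry.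
Qed.

Lemma measurable_col m n (f : T -> 'M[R]_(m, n)) k :
  measurable_fun setT f -> measurable_fun setT (fun t => col k (f t)).
Proof.
move=> mf; apply: measurable_fun_mx => i j.
by under eq_fun do rewrite mxE; exact: measurable_entry.
Qed.

Lemma measurable_det n (f : T -> 'M[R]_n) :
  (forall i j, measurable_fun setT (fun t => f t i j)) ->
  measurable_fun setT (fun t => \det (f t)).
Proof.
move=> mf; apply: measurable_sum => s; apply: measurable_funM => //.
by apply: measurable_prod.
Qed.

(** Inversion is discontinuous at 0. The power function applied to the square covers both signs, and
    the factor [f t] produces the conventional value 0 where [f] vanishes. *)
Lemma measurable_invr (f : T -> R) :
  measurable_fun setT f -> measurable_fun setT (fun t => (f t)^-1).
Proof.
move=> mf.
have -> : (fun t => (f t)^-1) = (fun t => f t * (f t ^+ 2) `^ (-1)).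
  apply/funext => t; rewrite powR_inv1 ?sqr_ge0//.
  have [->|f0] := eqVneq (f t) 0; first by rewrite invr0 mul0r.
  by rewrite expr2 invfM mulrA divff// mul1r.
apply: measurable_funM => //.
have : measurable_fun setT ((@powR R ^~ (-1)) \o (fun t => f t ^+ 2)).
  apply: measurableT_comp; first exact: measurable_powR.
  exact: measurable_funX.
exact.
Qed.

(** Cramer's rule on the set where the determinant is nonzero; elsewhere [invmx] returns its
    argument. *)
Lemma measurable_invmx n (f : T -> 'M[R]_n) :
  measurable_fun setT f -> measurable_fun setT (fun t => invmx (f t)).
Proof.
move=> mf.
have mdet : measurable_fun setT (fun t => \det (f t)).
  by apply: measurable_det => i j; exact: measurable_entry.
apply: measurable_fun_ifT => //.
  under eq_fun do rewrite unitmxE unitfE.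
  have : measurable_fun setT (fun t => \det (f t) == 0).
    exact: measurable_fun_eqr.
  by move/measurable_neg.
apply: measurable_fun_mx => i j.
under eq_fun do rewrite !mxE.
apply: measurable_funM; first exact: measurable_invr.
apply: measurable_funM => //; apply: measurable_det => k l.
by under eq_fun do rewrite !mxE; exact: measurable_entry.
Qed.

End operations.
End borel_matrices.

(** * The positive definite square root as a Borel map *)

Section spd_square_root.
Context (R : realType) (n : nat).
Implicit Types A B C D : 'M[R]_n.

(** The diagonal entries of [D *m B *m D] are the values of the quadratic form of [B] at the columns
    of [D]. *)
Lemma posdef_conj_trace_gt0 B D : sym_posdef B -> D^T = D -> D != 0 ->
  0 < \tr (D *m B *m D).
Proof.
move=> [_ Bpos] Dsym D0.
have E i : (D *m B *m D) i i = ((col i D)^T *m B *m col i D) 0 0.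
  by rewrite tr_col Dsym -row_mul -[in RHS]row_mul colE mulmxA -colE !mxE.
have [i Di] : exists i, col i D != 0.
  apply/existsP; apply: contraNT D0 => /existsPn H.
  apply/eqP/matrixP => i j; rewrite mxE.
  by have /negPn/eqP/matrixP/(_ i 0) := H j; rewrite !mxE.
rewrite /mxtrace (bigD1 i)//= E; apply: ltr_wpDr; last exact: Bpos.
apply: sumr_ge0 => j _; rewrite E.
have [->|/Bpos/ltW//] := eqVneq (col j D) 0.
by rewrite mulmx0 mxE.
Qed.

(** For [D = B - C], equal squares give [B *m D = - (D *m C)], so [D *m B *m D] and [D *m C *m D]
    have opposite traces; both would be positive if [D] were nonzero. *)
Lemma spd_sqrt_unique B C : sym_posdef B -> sym_posdef C ->
  B *m B = C *m C -> B = C.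
Proof.
move=> Bp Cp BC; apply/eqP; rewrite -subr_eq0; apply/negPn/negP => D0.
set D := B - C in D0.
have Dsym : D^T = D by rewrite /D linearB/= (proj1 Bp) (proj1 Cp).
have H : B *m D = - (D *m C).
  rewrite /D mulmxBr mulmxBl BC; apply/eqP; rewrite -addr_eq0.
  by rewrite addrA subrK subrr.
have := posdef_conj_trace_gt0 Bp Dsym D0.
have := posdef_conj_trace_gt0 Cp Dsym D0.
rewrite -(mulmxA D B D) H mulmxN linearN/= (mxtrace_mulC D (D *m C)).
by move=> DCD; rewrite oppr_gt0 => /(lt_trans DCD); rewrite ltxx.
Qed.

Lemma sym_posdef_det B : sym_posdef B -> \det B != 0.
Proof.
move=> [_ Bpos]; apply/negP => /det0P[v v0 vB].
have vT0 : v^T != 0 by rewrite -trmx0 (inj_eq trmx_inj).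
by have := Bpos _ vT0; rewrite trmxK vB mul0mx mxE ltxx.
Qed.

(** Compact pieces of the set of positive definite matrices: the strict inequality is relaxed to a
    closed one, and a determinant kept away from 0 restores definiteness. *)
Definition posdef_exhaustion (N : nat) : set 'M[R]_n :=
  [set B | [/\ B^T = B, forall x : 'cV[R]_n, 0 <= (x^T *m B *m x) 0 0,
     N.+1%:R^-1 <= `|\det B| & forall i j, `|B i j| <= N%:R]].

Lemma posdef_exhaustionP :
  @sym_posdef R n = \bigcup_N posdef_exhaustion N.
Proof.
apply/seteqP; split=> [B Bp|B [N _ [Bsym Bpos Bdet _]]].
  have d0 : 0 < `|\det B| by rewrite normr_gt0 sym_posdef_det.
  have [N1 _ HN1] := near_infty_natSinv_lt (PosNum d0).
  pose S := \sum_i \sum_j `|B i j|.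
  have [N2 HN2] : exists N2 : nat, S <= N2%:R.
    by exists (Num.bound S); apply/ltW/archi_boundP; do 2!apply: sumr_ge0 => ? _.
  exists (maxn N1 N2) => //; case: (Bp) => Bs Bpos; split => //.
  - move=> x; have [->|/Bpos/ltW//] := eqVneq x 0.
    by rewrite mulmx0 mxE.
  - apply/ltW/HN1; exact: leq_maxl.
  - move=> i j; apply: (@le_trans _ _ S).
      rewrite /S (bigD1 i)//= (bigD1 j)//= -addrA lerDl addr_ge0//.
        exact: sumr_ge0.
      by apply: sumr_ge0 => k _; exact: sumr_ge0.
    by apply: le_trans HN2 _; rewrite ler_nat leq_maxr.
split=> // x x0; rewrite lt_neqAle Bpos andbT eq_sym; apply/negP => /eqP xBx.
(* the nonnegative quadratic form vanishes at [x], hence to first order too *)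
have Bx (y : 'cV[R]_n) : (y^T *m B *m x) 0 0 = 0.
  have xBy : (x^T *m B *m y) 0 0 = (y^T *m B *m x) 0 0.
    rewrite -[in RHS](trmxK (y^T *m B *m x)) [RHS]mxE !trmx_mul trmxK Bsym.
    by rewrite mulmxA.
  have Q (t : R) : 0 <= 2 * t * (y^T *m B *m x) 0 0 + t ^+ 2 * (y^T *m B *m y) 0 0.
    have := Bpos (x + t *: y).
    have -> : (x + t *: y)^T = x^T + t *: y^T by rewrite linearD linearZ.
    rewrite !mulmxDl !mulmxDr -!scalemxAl -!scalemxAr.
    have mxD (P Q : 'M[R]_1) : (P + Q) 0 0 = P 0 0 + Q 0 0 by rewrite mxE.
    have mxZ (P : 'M[R]_1) : (t *: P) 0 0 = t * P 0 0 by rewrite mxE.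
    by rewrite !(mxD, mxZ) xBx xBy expr2; lra.
  set a := (y^T *m B *m x) 0 0 in Q *.
  set b := (y^T *m B *m y) 0 0 in Q.
  have b0 : 0 <= b by exact: Bpos.
  (* The minimum of the quadratic is at [- a / b]; the denominator [b + 1] avoids a division by 0
     and still gives a negative value unless [a = 0]. *)
  have := Q (- a / (b + 1)).
  have -> : 2 * (- a / (b + 1)) * a + (- a / (b + 1)) ^+ 2 * b
      = - (a ^+ 2 * ((b + 2) / (b + 1) ^+ 2)).
    by field; rewrite gt_eqF// ltr_wpDl.
  rewrite oppr_ge0 pmulr_lle0; last by rewrite divr_gt0 ?exprn_gt0//; lra.
  by move=> a2; apply/eqP; rewrite -sqrf_eq0 eq_le a2 sqr_ge0.
have /negP : \det B != 0.
  by rewrite -normr_gt0; apply: lt_le_trans Bdet; rewrite invr_gt0.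
apply; apply/det0P; exists x^T; first by rewrite -trmx0 (inj_eq trmx_inj).
apply/matrixP => i j; rewrite ord1 [RHS]mxE -[LHS]mulr1.
have := Bx (delta_mx j 0).
rewrite trmx_delta -rowE -row_mul mxE => H.
by rewrite -[x^T *m B]trmxK [LHS]mulr1 mxE trmx_mul trmxK Bsym.
Qed.

Lemma continuous_bigsum (T : topologicalType) I (r : seq I)
    (F : I -> T -> R) : (forall i, continuous (F i)) ->
  continuous (fun x => \sum_(i <- r) F i x).
Proof.
move=> cF; elim: r => [|i r IH] x.
  by under eq_fun do rewrite big_nil; exact: cst_continuous.
by under eq_fun do rewrite big_cons; apply: continuousD; [exact: cF|exact: IH].
Qed.

Lemma continuous_bigprod (T : topologicalType) I (r : seq I)
    (F : I -> T -> R) : (forall i, continuous (F i)) ->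
  continuous (fun x => \prod_(i <- r) F i x).
Proof.
move=> cF; elim: r => [|i r IH] x.
  by under eq_fun do rewrite big_nil; exact: cst_continuous.
by under eq_fun do rewrite big_cons; apply: continuousM; [exact: cF|exact: IH].
Qed.

Lemma continuous_mx (T : topologicalType) p q (f : T -> 'M[R]_(p, q)) :
  (forall i j, continuous (fun t => f t i j)) -> continuous f.
Proof.
move=> cf t A [P tP PA].
apply: (@filterS _ (nbhs t) _ [set s | forall i j, P i j (f s i j)]).
  by move=> s H; exact: PA.
apply: filter_forall => i; apply: filter_forall => j.
by have := cf i j t; apply.
Qed.

Lemma compact_mx_box p q (N : R) :
  compact [set M : 'M[R]_(p, q) | forall i j, `|M i j| <= N].
Proof.
have -> : [set M : 'M[R]_(p, q) | forall i j, `|M i j| <= N] =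
    vec_mx @` [set v : 'rV[R]_(p * q) | forall i, `[- N, N]%classic (v ord0 i)].
  apply/seteqP; split=> [M MN|_ [v vN <-] i j].
    exists (mxvec M); last by rewrite mxvecK.
    by move=> k; case/mxvec_indexP: k => i j; rewrite mxvecE /= in_itv/= -ler_norml.
  by rewrite mxE ler_norml; have := vN (mxvec_index i j); rewrite /= in_itv.
apply: continuous_compact.
  apply: continuous_subspaceT; apply: continuous_mx => i j.
  by under eq_fun do rewrite mxE; exact: coord_continuous.
by apply: (@rV_compact _ _ (fun=> `[- N, N]%classic)) => _; exact: segment_compact.
Qed.

Lemma compact_posdef_exhaustion N : compact (posdef_exhaustion N).
Proof.
have -> : posdef_exhaustion N =
    [set B : 'M[R]_n | forall i j, `|B i j| <= N%:R] `&`
    ([set B : 'M[R]_n | forall i j, B j i - B i j = 0] `&`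
    ([set B : 'M[R]_n | forall x : 'cV[R]_n, 0 <= (x^T *m B *m x) 0 0] `&`
     [set B : 'M[R]_n | N.+1%:R^-1 <= `|\det B|])).
  apply/seteqP; split=> [B [B1 B2 B3 B4]|B [B1 [B2 [B3 B4]]]]; split=> //.
    by split=> // i j; rewrite -{2}B1 mxE subrr.
  by apply/matrixP => i j; rewrite mxE; apply/eqP; rewrite -subr_eq0 B2.
apply: compact_closedI; first exact: compact_mx_box.
have cfc (f : 'M[R]_n -> R) (A : set R) :
    continuous f -> closed A -> closed (f @^-1` A).
  by move=> cf cA; apply: closed_comp => // x _; exact: cf.
apply: closedI; last apply: closedI.
- rewrite (_ : mkset _ = \bigcap_i \bigcap_j
      ((fun B : 'M[R]_n => B j i - B i j) @^-1` [set 0])); last first.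
    by apply/seteqP; split=> B H => [i _ j _|i j]; exact: H.
  apply: closed_bigI => i _; apply: closed_bigI => j _.
  apply: cfc; last exact: closed_eq.
  by move=> x; apply: continuousB; exact: coord_continuous.
- rewrite (_ : mkset _ = \bigcap_(x : 'cV[R]_n)
      ((fun B : 'M[R]_n => (x^T *m B *m x) 0 0) @^-1` [set y | 0 <= y])); last first.
    by apply/seteqP; split=> B H => [x _|x]; exact: H.
  apply: closed_bigI => x _; apply: cfc; last exact: closed_ge.
  under eq_fun do rewrite mxE; apply: continuous_bigsum => i.
  under eq_fun do rewrite mxE.
  move=> B; apply: continuousM; last exact: cst_continuous.
  apply: continuous_bigsum => j C; apply: continuousM.
    exact: cst_continuous.
  exact: coord_continuous.
- apply: (cfc (fun B => `|\det B|) [set y | N.+1%:R^-1 <= y]); last exact: closed_ge.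
  have cdet : continuous (fun B : 'M[R]_n => \det B).
    apply: (@continuous_bigsum _ _ _
      (fun (s : {perm 'I_n}) (B : 'M[R]_n) => (-1) ^+ s * \prod_i B i (s i))) => s B.
    apply: (@continuousM _ _ (fun=> (-1) ^+ s)); first exact: cst_continuous.
    by apply: continuous_bigprod => i; exact: coord_continuous.
  move=> B; apply: (@continuous_comp _ _ _ (fun B => \det B)).
    exact: cdet.
  exact: norm_continuous.
Qed.

(* No existence of square roots is needed: squaring is injective on the
   sigma-compact set of positive definite matrices, so the preimage of a closed
   set is, up to the default branch, a countable union of compact images. *)
Lemma measurable_spd_sqrt :
  measurable_fun setT (@spd_sqrt R n).
Proof.
pose sq (B : 'M[R]_n) := B *m B.
have csq : continuous sq.
  apply: continuous_mx => i j; under eq_fun do rewrite mxE.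
  by apply: continuous_bigsum => k B; apply: continuousM; exact: coord_continuous.
have mK (F : set 'M[R]_n) : closed F ->
    measurable (\bigcup_N (sq @` (posdef_exhaustion N `&` F))).
  move=> cF; apply: bigcupT_measurable => N.
  apply: closed_measurable_mx; apply: compact_closed; first exact: norm_hausdorff.
  apply: continuous_compact; first exact: continuous_subspaceT.
  by apply: compact_closedI => //; exact: compact_posdef_exhaustion.
have mF (F : set 'M[R]_n) : closed F -> measurable (@spd_sqrt R n @^-1` F).
  move=> cF.
  (* Matrices that are not squares of positive definite ones are sent to [1%:M], so they belong to
     the preimage exactly when [F] contains the identity. *)
  rewrite (_ : _ @^-1` _ = \bigcup_N (sq @` (posdef_exhaustion N `&` F)) `|`
      (if `[< F 1%:M >]
       then ~` \bigcup_N (sq @` (posdef_exhaustion N `&` setT)) else set0)).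
    apply: measurableU; first exact: mK.
    by case: ifP => // _; apply: measurableC; apply: mK; exact: closedT.
  have ex A : (exists B, sym_posdef B /\ B *m B = A) <->
      (\bigcup_N (sq @` (posdef_exhaustion N `&` setT))) A.
    split.
      move=> [B [+ <-]]; rewrite posdef_exhaustionP => -[N _ BN].
      by exists N => //; exists B.
    move=> [N _ [B [BN _] <-]]; exists B; split => //.
    by rewrite posdef_exhaustionP; exists N.
  have sqrtE B : sym_posdef B -> spd_sqrt (B *m B) = B.
    move=> Bp; rewrite /spd_sqrt; set P := mkset _.
    have [Cp CC] : P (xget 1%:M P) by apply: xgetPex; exists B.
    exact: spd_sqrt_unique.
  have sqrtN A : ~ (exists B, sym_posdef B /\ B *m B = A) -> spd_sqrt A = 1%:M.
    by move=> nA; apply: xgetPN => B BA; apply: nA; exists B.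
  apply/seteqP; split=> [A /= FA|A].
    have [[B [Bp BA]]|nA] := pselect (exists B, sym_posdef B /\ B *m B = A).
      left; move: (Bp); rewrite posdef_exhaustionP => -[N _ BN].
      by exists N => //; exists B => //; split => //; rewrite -(sqrtE B Bp) BA.
    right; rewrite asboolT; first by move/ex.
    by rewrite -(sqrtN A nA).
  case=> [[N _ [B [BN FB] <-]]|/=].
    rewrite /preimage /mkset /sq sqrtE//.
    by rewrite posdef_exhaustionP; exists N.
  case: ifPn => // /asboolP F1 /ex nA.
  by rewrite /preimage /mkset sqrtN.
apply: (measurability [set A : set 'M[R]_n | open A]) => //.
move=> _ [A oA <-]; rewrite setTI -(setCK A) -preimage_setC.
by apply: measurableC; apply: mF; exact: open_closedC.
Qed.

End spd_square_root.

Section etkf_measurability.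
Context (R : realType) (q d K : nat) (H : 'M[R]_(q, d)).
Context (dT : measure_display) (T : measurableType dT).

Lemma measurable_ens_mean (V : T -> 'M[R]_(d, K)) : measurable_fun setT V ->
  measurable_fun setT (fun t => ens_mean (V t)).
Proof.
move=> mV; apply: measurable_scalemx; apply: measurable_fun_mx => i j.
under eq_fun do rewrite summxE; apply: measurable_sum => k.
by apply: measurable_entry; exact: measurable_col.
Qed.

Lemma measurable_ens_dev (V : T -> 'M[R]_(d, K)) : measurable_fun setT V ->
  measurable_fun setT (fun t => ens_dev (V t)).
Proof.
move=> mV; apply: measurable_fun_mx => i j; under eq_fun do rewrite mxE.
apply: measurable_funB; apply: measurable_entry => //.
exact: measurable_ens_mean.
Qed.

Lemma measurable_ens_cov (V : T -> 'M[R]_(d, K)) : measurable_fun setT V ->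
  measurable_fun setT (fun t => ens_cov (V t)).
Proof.
move=> mV; apply: measurable_scalemx; apply: measurable_mulmx.
  exact: measurable_ens_dev.
by apply: measurable_trmx; exact: measurable_ens_dev.
Qed.

Lemma measurable_etkf_transform (S : T -> 'M[R]_(d, K)) :
  measurable_fun setT S ->
  measurable_fun setT (fun t => etkf_transform H (S t)).
Proof.
move=> mS; apply: measurable_invmx.
apply: (measurableT_comp (@measurable_spd_sqrt R K)).
apply: measurable_addmx => //; apply: measurable_scalemx.
do 3?[apply: measurable_mulmx => //].
exact: measurable_trmx.
Qed.

Lemma measurable_etkf_assimilate (V : T -> 'M[R]_(d, K)) (z : T -> 'cV[R]_q) :
  measurable_fun setT V -> measurable_fun setT z ->
  measurable_fun setT (fun t => etkf_assimilate H (V t) (z t)).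
Proof.
move=> mV mz.
have mm := measurable_ens_mean mV.
have mC := measurable_ens_cov mV.
have mS := measurable_ens_dev mV.
have mT := measurable_etkf_transform mS.
apply: measurable_fun_mx => i j; under eq_fun do rewrite mxE.
apply: measurable_funD; apply: measurable_entry; last exact: measurable_mulmx.
apply: measurable_submx => //; apply: measurable_mulmx.
  do 2?[apply: measurable_mulmx => //].
  apply: measurable_invmx; apply: measurable_addmx => //.
  by do 2?[apply: measurable_mulmx => //].
by apply: measurable_submx => //; apply: measurable_mulmx.
Qed.

Lemma measurable_etkf_forecast (Psi : 'cV[R]_d -> 'cV[R]_d)
    (V zeta : T -> 'M[R]_(d, K)) :
  measurable_fun setT Psi ->
  measurable_fun setT V -> measurable_fun setT zeta ->
  measurable_fun setT (fun t => etkf_forecast Psi (V t) (zeta t)).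
Proof.
move=> mPsi mV mz; apply: measurable_fun_mx => i k.
under eq_fun do rewrite mxE; apply: measurable_funD; apply: measurable_entry => //.
by apply: (measurableT_comp mPsi); exact: measurable_col.
Qed.

End etkf_measurability.

(** * Lebesgue measure on columns *)

Section lebesgue_on_columns.
Context (R : realType).

Definition cV_cons p (t : R * 'cV[R]_p) : 'cV[R]_p.+1 := col_mx t.1%:M t.2.

Lemma cV_cons0 p (t : R * 'cV[R]_p) j : cV_cons t ord0 j = t.1.
Proof.
by rewrite /cV_cons mxE; case: splitP => k //= _; rewrite !ord1 mxE mulr1n.
Qed.

Lemma cV_consS p (t : R * 'cV[R]_p) i j : cV_cons t (lift ord0 i) j = t.2 i j.
Proof.
rewrite /cV_cons mxE; case: splitP => k /= => [|[ik]].
  by rewrite ord1.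
by congr (t.2 _ j); exact/val_inj.
Qed.

Lemma measurable_cV_cons p : measurable_fun setT (@cV_cons p).
Proof.
apply: measurable_fun_mx => i j; case: (unliftP ord0 i) => [k ->|->].
  under eq_fun do rewrite cV_consS.
  by apply: measurable_entry; exact: measurable_snd.
by under eq_fun do rewrite cV_cons0; exact: measurable_fst.
Qed.

Lemma lebesgue_cVSE p (A : set 'cV[R]_p.+1) :
  lebesgue_cV A = (@lebesgue_measure R \x @lebesgue_cV R p)%E
    ((@cV_cons p) @^-1` A).
Proof.
apply: eq_integral => x _ /=; congr lebesgue_cV.
by apply/seteqP; split=> v /=; rewrite /xsection/= ?inE// in_setE.
Qed.

Definition cV_box p (e : R) : set 'cV[R]_p := [set v | forall i, `|v i 0| <= e].

Lemma measurable_cV_box p e : measurable (@cV_box p e).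
Proof.
rewrite (_ : cV_box e = \bigcap_(i in [set: 'I_p])
  ((fun v : 'cV[R]_p => v i 0) @^-1` `[- e, e]%classic)); last first.
  by apply/seteqP; split=> [v H i _|v H i];
    [rewrite /= in_itv/= -ler_norml|have := H i I; rewrite /= in_itv/= ler_norml].
apply: fin_bigcap_measurable => // i _.
by rewrite -[X in measurable X]setTI; exact: measurable_coord.
Qed.

Lemma bigcup_cV_box p : \bigcup_n (@cV_box p n.+1%:R) = setT.
Proof.
apply/seteqP; split=> // v _; pose s := \sum_i `|v i 0|.
have s0 : 0 <= s by exact: sumr_ge0.
exists (Num.bound s) => // i; rewrite -natr1.
apply: (@le_trans _ _ s); last by have := archi_boundP s0; lra.
by rewrite /s (bigD1 i)//= lerDl sumr_ge0.
Qed.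

(** The recursion defines a mere set function. Being a sigma-finite measure is carried through the
    induction because the next product requires it, and the volumes of cubes supply the
    sigma-finiteness. *)
Lemma lebesgue_cV_sigma_finite_box p :
  exists2 mu : {sigma_finite_measure set 'cV[R]_p -> \bar R},
    @lebesgue_cV R p = mu &
    forall e, 0 < e -> mu (cV_box e) = ((2 * e) ^+ p)%:E.
Proof.
elim: p => [|p [mu muE mu_box]].
  exists (\d_(0 : 'cV[R]_0))%R => // e e0.
  by rewrite /= diracE mem_set// => -[].
pose push := (pushforward (@lebesgue_measure R \x mu)%E (@cV_cons p) :
  {measure set 'cV[R]_p.+1 -> \bar R}).
pose m := push (@measurable_cV_cons p).
have mE : @lebesgue_cV R p.+1 = m.
  by apply/funext => A; rewrite lebesgue_cVSE muE.
have m_box e : 0 < e -> m (cV_box e) = ((2 * e) ^+ p.+1)%:E.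
  move=> e0; rewrite -mE lebesgue_cVSE muE.
  rewrite (_ : _ @^-1` _ = `[- e, e]%classic `*` cV_box e); last first.
    apply/seteqP; split=> [[x v] /= H|[x v] [/= xe ve] i].
      split=> [|i].
        by have := H ord0; rewrite cV_cons0/= in_itv/= ler_norml.
      by have := H (lift ord0 i); rewrite cV_consS.
    case: (unliftP ord0 i) => [k ->|->]; rewrite ?cV_consS ?cV_cons0//=.
    by rewrite in_itv/= in xe; rewrite ler_norml.
  rewrite product_measure1E//; last exact: measurable_cV_box.
  have leb : lebesgue_measure `[- e, e]%classic = (2 * e)%:E.
    rewrite lebesgue_measure_itv/= lte_fin ifT; last by lra.
    by rewrite -EFinB; congr EFin; lra.
  by rewrite mu_box// [X in (X * _)%E]leb -EFinM exprS.
have sf : sigma_finite setT m.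
  exists (fun n => cV_box n.+1%:R); first by rewrite bigcup_cV_box.
  by move=> n; split; [exact: measurable_cV_box|rewrite m_box// ltry].
pose M := Measure_isSigmaFinite.Build _ _ _ m sf.
pose mu' : {sigma_finite_measure set 'cV[R]_p.+1 -> \bar R} :=
  HB.pack (m : set 'cV[R]_p.+1 -> \bar R) (Measure.on m) M.
by exists mu'.
Qed.

Lemma lebesgue_cV_sigma_finite p :
  exists mu : {sigma_finite_measure set 'cV[R]_p -> \bar R},
    @lebesgue_cV R p = mu.
Proof. by have [mu muE _] := lebesgue_cV_sigma_finite_box p; exists mu. Qed.

Lemma lebesgue_cV_box p (e : R) : 0 < e ->
  lebesgue_cV (@cV_box p e) = ((2 * e) ^+ p)%:E.
Proof.
by have [mu -> mu_box] := lebesgue_cV_sigma_finite_box p; exact: mu_box.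
Qed.

Lemma lebesgue_shift (a : R) (A : set R) : measurable A ->
  lebesgue_measure [set x : R | A (a + x)] = lebesgue_measure A.
Proof.
move=> mA; have mf : measurable_fun setT (fun x : R => a + x).
  exact: measurable_funD.
pose f (x : measurableTypeR R) : measurableTypeR R := a + x.
pose pushf := (pushforward (@lebesgue_measure R) f :
  {measure set (measurableTypeR R) -> \bar R}).
apply/esym; apply: (lebesgue_measure_unique (mu := pushf mf)) => //.
move=> _ [[x y] _ <-] /=; rewrite /pushforward.
rewrite (_ : _ @^-1` _ = `]x - a, y - a]%classic); last first.
  by apply/seteqP; split=> z /=; rewrite /f !in_itv/= ltrBlDl lerBrDl.
by rewrite !lebesgue_measure_itv/= !lte_fin ltrD2r; case: ifPn => // _;
  rewrite -!EFinB opprB addrA subrK.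
Qed.

Lemma ge0_integral_lebesgue_shift (a : R) (f : R -> \bar R) :
  measurable_fun setT f -> (forall x, 0 <= f x)%E ->
  (\int[@lebesgue_measure R]_x f (a + x)%R = \int[@lebesgue_measure R]_x f x)%E.
Proof.
move=> mf f0.
have ma : measurable_fun setT (fun x : R => a + x) by exact: measurable_funD.
have := @ge0_integral_pushforward _ _ (measurableTypeR R) (measurableTypeR R) R
  _ ma (@lebesgue_measure R) setT f measurableT mf (fun x _ => f0 x).
rewrite preimage_setT => <-.
by apply: eq_measure_integral => A mA _; exact: lebesgue_shift.
Qed.

(** The first coordinate is handled by translation invariance on the line, the others by the
    induction hypothesis on each section. *)
Lemma lebesgue_cV_shift p (a : 'cV[R]_p) (A : set 'cV[R]_p) : measurable A ->
  lebesgue_cV [set z | A (a + z)] = lebesgue_cV A.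
Proof.
elim: p a A => [|p IH] a A mA.
  rewrite (_ : [set z | _] = A)//; apply/seteqP; split=> z /=;
  by rewrite (_ : a + z = z)//; apply/matrixP => -[].
have [mu muE] := lebesgue_cV_sigma_finite p.
have mAc : measurable (@cV_cons p @^-1` A).
  by rewrite -[X in measurable X]setTI; exact: measurable_cV_cons.
pose f (x : R) := mu (xsection (@cV_cons p @^-1` A) x).
rewrite [RHS]lebesgue_cVSE muE [RHS]/product_measure1.
transitivity (\int[@lebesgue_measure R]_x f (a ord0 0 + x)%R)%E; last first.
  apply: ge0_integral_lebesgue_shift => //.
  exact: (measurable_fun_xsection mu mAc).
apply: eq_integral => x _; rewrite /f -muE.
rewrite -(IH (\matrix_(i, j) a (lift ord0 i) j)); last first.
  exact: measurable_xsection.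
have shiftE (v : 'cV[R]_p) : a + cV_cons (x : R, v) = cV_cons (a ord0 0 + x,
    \matrix_(i, j) a (lift ord0 i) j + v).
  apply/matrixP => i j; rewrite mxE.
  case: (unliftP ord0 i) => [k ->|->].
    by rewrite !cV_consS/= !mxE.
  by rewrite !cV_cons0 ord1.
by congr lebesgue_cV; apply/seteqP; split=> v /=;
  rewrite /xsection/= inE /preimage/= -shiftE.
Qed.

End lebesgue_on_columns.

(** * Product laws and minorization *)

Section product_minorization.
Context (R : realType).

(** The first factors are exchanged under the integral of the sections, then the second factors
    section by section. *)
Lemma minorized_product d1 d2 (T1 : measurableType d1) (T2 : measurableType d2)
    (l1 p1 : probability T1 R) (l2 p2 : probability T2 R) (a b : R) :
  0 <= a -> 0 <= b ->
  (forall A, measurable A -> (a%:E * l1 A <= p1 A)%E) ->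
  (forall A, measurable A -> (b%:E * l2 A <= p2 A)%E) ->
  forall W, measurable W -> ((a * b)%:E * (l1 \x l2) W <= (p1 \x p2) W)%E.
Proof.
move=> a0 b0 al bl W mW.
have m2 := measurable_fun_xsection l2 mW.
have m2' := measurable_fun_xsection p2 mW.
have -> : ((a * b)%:E * (l1 \x l2) W =
    a%:E * \int[l1]_x (b%:E * (l2 \o xsection W) x))%E.
  by rewrite EFinM -muleA ge0_integralZl.
apply: (@le_trans _ _ (\int[p1]_x (b%:E * (l2 \o xsection W) x))%E).
  apply: minorized_integral => //.
    exact: measurable_funeM.
  by move=> x; apply: mule_ge0 => //; rewrite lee_fin.
apply: ge0_le_integral => //.
- by move=> x _; apply: mule_ge0 => //; rewrite lee_fin.
- exact: measurable_funeM.
- by move=> x _; apply: bl; exact: measurable_xsection.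
Qed.

Lemma probability_image d1 d2 (T1 : measurableType d1) (T2 : measurableType d2)
    (p : probability T1 R) (f : T1 -> T2) : measurable_fun setT f ->
  exists p' : probability T2 R, forall A, p' A = p (f @^-1` A).
Proof.
move=> mf.
pose F : {mfun T1 >-> T2} := HB.pack f (isMeasurableFun.Build _ _ _ _ f mf).
by exists (distribution p F).
Qed.

Definition mx_cons d K (t : 'cV[R]_d * 'M[R]_(d, K)) : 'M[R]_(d, K.+1) :=
  row_mx t.1 t.2.

Lemma col0_mx_cons d K (t : 'cV[R]_d * 'M[R]_(d, K)) :
  col ord0 (mx_cons t) = t.1.
Proof.
apply/matrixP => i j; rewrite !mxE; case: splitP => k //= _.
by rewrite !ord1.
Qed.

Lemma colS_mx_cons d K (t : 'cV[R]_d * 'M[R]_(d, K)) k :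
  col (lift ord0 k) (mx_cons t) = col k t.2.
Proof.
apply/matrixP => i j; rewrite !mxE; case: splitP => l /= => [|[kl]].
  by rewrite ord1.
by congr (t.2 i _); exact/val_inj.
Qed.

Lemma measurable_mx_cons d K : measurable_fun setT (@mx_cons d K).
Proof.
apply: measurable_fun_mx => i k; case: (unliftP ord0 k) => [j ->|->].
  have E (t : 'cV[R]_d * 'M[R]_(d, K)) : mx_cons t i (lift ord0 j) = t.2 i j.
    transitivity (col (lift ord0 j) (mx_cons t) i 0); first by rewrite [RHS]mxE.
    by rewrite colS_mx_cons mxE.
  by under eq_fun do rewrite E; apply: measurable_entry; exact: measurable_snd.
have E (t : 'cV[R]_d * 'M[R]_(d, K)) : mx_cons t i ord0 = t.1 i 0.
  by rewrite -(col0_mx_cons t) [RHS]mxE.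
by under eq_fun do rewrite E; apply: measurable_entry; exact: measurable_fst.
Qed.

Definition column_rectangle d K (B : 'I_K -> set 'cV[R]_d) : set 'M[R]_(d, K) :=
  [set M | forall k, B k (col k M)].

Lemma measurable_column_rectangle d K (B : 'I_K -> set 'cV[R]_d) :
  (forall k, measurable (B k)) -> measurable (column_rectangle B).
Proof.
move=> mB; rewrite (_ : column_rectangle B = \bigcap_(k in [set: 'I_K])
    (col k @^-1` B k)); last first.
  by apply/seteqP; split=> [M H k _|M H k]; exact: H.
apply: fin_bigcap_measurable => // k _.
by rewrite -[X in measurable X]setTI; exact: measurable_col.
Qed.

(** [L], the law of [K] independent columns drawn from [l], is fixed before the column laws [p]: one
    law then serves all ensembles in a sublevel set. *)
Lemma independent_columns_minorized d K (l : probability 'cV[R]_d R) :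
  exists L : probability 'M[R]_(d, K) R,
    forall (a : R) (p : 'I_K -> probability 'cV[R]_d R), 0 <= a ->
      (forall k B, measurable B -> (a%:E * l B <= p k B)%E) ->
      exists2 Q : probability 'M[R]_(d, K) R,
        forall B : 'I_K -> set 'cV[R]_d, (forall k, measurable (B k)) ->
          Q (column_rectangle B) = (\prod_(k < K) p k (B k))%E &
        forall W, measurable W -> ((a ^+ K)%:E * L W <= Q W)%E.
Proof.
elim: K => [|K [L HL]].
  exists (\d_(0 : 'M[R]_(d, 0)))%R => a p a0 _.
  exists (\d_(0 : 'M[R]_(d, 0)))%R => [B mB|W mW].
    by rewrite big_ord0 /= diracE mem_set// => -[].
  by rewrite expr0 mul1e.
have mc := @measurable_mx_cons d K.
have mcW W : measurable W -> measurable (@mx_cons d K @^-1` W).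
  by move=> mW; rewrite -[X in measurable X]setTI; exact: mc.
have [L' L'E] := probability_image (l \x L)%E mc.
exists L' => a p a0 ap.
have [Q QE Qmin] := HL a (fun k => p (lift ord0 k)) a0 (fun k => ap (lift ord0 k)).
have [Q' Q'E] := probability_image (p ord0 \x Q)%E mc.
exists Q' => [B mB|W mW]; last first.
  rewrite L'E Q'E exprS; apply: minorized_product => //.
  - by rewrite exprn_ge0.
  - exact: ap.
  - exact: mcW.
rewrite Q'E (_ : _ @^-1` _ = B ord0 `*` column_rectangle (fun k => B (lift ord0 k))).
  have mR := measurable_column_rectangle (fun k => mB (lift ord0 k)).
  apply: eq_trans (@product_measure1E _ _ _ _ _ (p ord0) Q _ _ (mB ord0) mR) _.
  by rewrite big_ord_recl; congr (_ * _)%E; exact: QE.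
apply/seteqP; split=> [t H|t [H0 HS] k].
  split=> [|k]; first by have := H ord0; rewrite col0_mx_cons.
  by have := H (lift ord0 k); rewrite colS_mx_cons.
by case: (unliftP ord0 k) => [j ->|->]; rewrite ?colS_mx_cons ?col0_mx_cons.
Qed.

End product_minorization.

(** * Minorization of one forecast, uniformly on bounded sets *)

Section local_minorization.
Context (R : realType) (d : nat).

Lemma enorm_sqr p (x : 'cV[R]_p) : enorm x ^+ 2 = \sum_(i < p) x i 0 ^+ 2.
Proof. by rewrite sqr_sqrtr// sumr_ge0// => i _; exact: sqr_ge0. Qed.

Lemma enorm_le p (x : 'cV[R]_p) (M : R) : 0 <= M ->
  (enorm x <= M) = (\sum_(i < p) x i 0 ^+ 2 <= M ^+ 2).
Proof.
by move=> M0; rewrite -enorm_sqr ler_pXn2r// ?nnegrE// sqrtr_ge0.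
Qed.

Lemma measurable_enorm_ball p (M : R) : 0 <= M ->
  measurable [set x : 'cV[R]_p | enorm x <= M].
Proof.
move=> M0; rewrite (_ : mkset _ =
    (fun x : 'cV[R]_p => \sum_(i < p) x i 0 ^+ 2) @^-1` `]-oo, M ^+ 2]%classic).
  rewrite -[X in measurable X]setTI.
  have : measurable_fun setT (fun x : 'cV[R]_p => \sum_(i < p) x i 0 ^+ 2).
    by apply: measurable_sum => i; apply: measurable_funX; exact: measurable_coord.
  exact.
by apply/seteqP; split=> x /=; rewrite in_itv/= enorm_le.
Qed.

Lemma cV_box_enorm (z : 'cV[R]_d) : cV_box d.+1%:R^-1 z ->
  \sum_(i < d) z i 0 ^+ 2 <= 1.
Proof.
move=> zb; have d0 : 0 < d.+1%:R^-1 :> R by rewrite invr_gt0.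
apply: (@le_trans _ _ (\sum_(i < d) d.+1%:R^-1)).
  apply: ler_sum => i _; rewrite -real_normK ?num_real//.
  apply: le_trans (zb i); rewrite expr2 ler_piMl//.
  by apply: le_trans (zb i) _; rewrite invf_le1// ler1n.
rewrite sumr_const card_ord -[_ *+ d]mulr_natr mulrC ler_pdivrMr// mul1r.
by rewrite ler_nat.
Qed.

(** Used to drop the trace from the kinetic energy principle, leaving a bound on the deterministic
    forecast. *)
Lemma cov_trace_ge0 (P : {measure set 'cV[R]_d -> \bar R}) (m : 'cV[R]_d)
    (S : 'M[R]_d) : has_mean_cov P m S -> 0 <= \tr S.
Proof.
move=> [_ _ cov]; apply: sumr_ge0 => i _.
rewrite -lee_fin -cov; apply: integral_ge0 => z _.
by rewrite lee_fin -expr2 sqr_ge0.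
Qed.

(** [l] is uniform on the cube of half-side [1 / (d + 1)] about the origin, which lies in the unit
    ball; only the constant [a] depends on [M]. *)
Lemma shifted_noise_minorized (Psi : 'cV[R]_d -> 'cV[R]_d)
    (S : 'cV[R]_d -> 'M[R]_d) (kap : R.-pker 'cV[R]_d ~> 'cV[R]_d) (b c : R) :
  0 < b < 1 -> 0 < c -> (forall u, has_mean_cov (kap u) 0 (S u)) ->
  (forall u, enorm (Psi u) ^+ 2 + \tr (S u) <= (1 - b) * enorm u ^+ 2 + c) ->
  (forall M1 M2 : R, 0 < M1 -> 0 < M2 -> exists2 a : R, 0 < a &
     forall u, enorm u <= M1 -> forall A, measurable A ->
       (a%:E * lebesgue_cV (A `&` [set x | (enorm x <= M2)%R])
        <= kap u A)%E) ->
  exists l : probability 'cV[R]_d R, forall M : R, 0 < M ->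
    exists2 a : R, 0 < a & forall u, enorm u <= M -> forall B, measurable B ->
      (a%:E * l B <= kap u [set z | B (Psi u + z)%R])%E.
Proof.
move=> /andP[b0 b1] c0 cov kin nondeg.
pose e : R := d.+1%:R^-1; have e0 : 0 < e by rewrite invr_gt0.
have ed0 : 0 < (2 * e) ^+ d by rewrite exprn_gt0// mulr_gt0.
have [mu muE] := lebesgue_cV_sigma_finite R d.
have mbox := @measurable_cV_box R d e.
have mubox : mu (cV_box e) = ((2 * e) ^+ d)%:E.
  by rewrite -muE; exact: lebesgue_cV_box.
pose m0 : {measure set 'cV[R]_d -> \bar R} := mrestr mu mbox.
have lT : m0 setT = ((2 * e) ^+ d)%:E by rewrite /m0 /= /mrestr setTI.
pose l : probability 'cV[R]_d R := mnormalize m0 (\d_(0 : 'cV[R]_d))%R.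
have lE B : l B = (mu (B `&` cV_box e) * ((2 * e) ^+ d)^-1%:E)%E.
  change (mnormalize m0 (\d_(0 : 'cV[R]_d))%R B =
    (m0 B * ((2 * e) ^+ d)^-1%:E)%E).
  by rewrite /mnormalize lT orbF eqe gt_eqF.
exists l => M M0.
pose C := M ^+ 2 + c; have C0 : 0 <= C by rewrite addr_ge0 ?sqr_ge0// ltW.
(* [C] bounds the squared norm of [Psi u], so a noise carrying [Psi u] into the cube has squared
   norm at most [2 + 2 * C]. This number exceeds 1, hence is below its square and also serves as the
   radius. *)
have M20 : 0 < 2 + 2 * C by lra.
have [a a0 aP] := nondeg M (2 + 2 * C) M0 M20.
(* The volume of the cube undoes the normalization of [l]. *)
exists (a * (2 * e) ^+ d); first exact: mulr_gt0.
move=> u uM B mB.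
have mPsi (A : set 'cV[R]_d) : measurable A -> measurable [set z | A (Psi u + z)].
  move=> mA.
  have mf : measurable_fun setT (fun z : 'cV[R]_d => Psi u + z).
    exact: measurable_addmx.
  by rewrite -[X in measurable X]setTI; exact: mf.
apply: le_trans (aP u uM _ (mPsi B mB)).
rewrite lE muleCA -!EFinM.
rewrite (_ : (mu (B `&` cV_box e) * _)%E = (a%:E * mu (B `&` cV_box e))%E); last first.
  rewrite muleC; congr (_ * _)%E; congr EFin.
  by rewrite mulfK// gt_eqF.
rewrite lee_wpmul2l ?lee_fin ?(ltW a0)// muE.
have <- : lebesgue_cV [set z | (B `&` cV_box e) (Psi u + z)]
    = mu (B `&` cV_box e).
  by rewrite lebesgue_cV_shift ?muE//; exact: measurableI.
rewrite muE; apply: le_measure; rewrite ?inE.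
- by apply: mPsi; exact: measurableI.
- by apply: measurableI; [exact: mPsi|apply: measurable_enorm_ball; exact: ltW].
move=> z /= [Bz boxz]; split => //.
rewrite enorm_le; last exact: ltW.
have PsiC : \sum_(i < d) Psi u i 0 ^+ 2 <= C.
  rewrite -enorm_sqr; have := kin u; have := cov_trace_ge0 (cov u).
  have : enorm u ^+ 2 <= M ^+ 2.
    by rewrite ler_pXn2r// ?nnegrE ?sqrtr_ge0// ltW.
  have : 0 <= enorm u ^+ 2 by exact: sqr_ge0.
  rewrite /C; set x := enorm u ^+ 2; set y := enorm _ ^+ 2; nra.
apply: (@le_trans _ _ (2 + 2 * C)); last first.
  by rewrite expr2 ler_peMl ?ltW//; lra.
apply: (@le_trans _ _ (\sum_(i < d) (2 * ((Psi u + z) i 0 ^+ 2) +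
    2 * (Psi u i 0 ^+ 2)))).
  apply: ler_sum => i _; rewrite mxE.
  have := sqr_ge0 (z i 0 + 2 * Psi u i 0); rewrite !expr2; lra.
rewrite big_split/= -!mulr_sumr.
have := cV_box_enorm boxz; lra.
Qed.

Lemma compact_sublevel_bound K (E : 'cV[R]_d * 'M[R]_(d, K) -> R) (a : R) :
  compact [set x | E x <= a] ->
  exists2 M : R, 0 < M & forall x, E x <= a ->
    enorm x.1 <= M /\ forall k, enorm (col k x.2) <= M.
Proof.
move=> cE.
pose f (x : 'cV[R]_d * 'M[R]_(d, K)) : R :=
  \sum_i x.1 i 0 ^+ 2 + \sum_k \sum_i x.2 i k ^+ 2.
have cf : continuous f.
  have c1 i : continuous (fun x : 'cV[R]_d * 'M[R]_(d, K) => x.1 i 0 ^+ 2).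
    move=> x; apply: (@continuousM _ _ (fun x : 'cV[R]_d * 'M[R]_(d, K) => x.1 i 0)
      (fun x : 'cV[R]_d * 'M[R]_(d, K) => x.1 i 0));
    by apply: (@continuous_comp _ _ _ fst (fun v : 'cV[R]_d => v i 0));
      [exact: cvg_fst|exact: coord_continuous].
  have c2 k i : continuous (fun x : 'cV[R]_d * 'M[R]_(d, K) => x.2 i k ^+ 2).
    move=> x; apply: (@continuousM _ _ (fun x : 'cV[R]_d * 'M[R]_(d, K) => x.2 i k)
      (fun x : 'cV[R]_d * 'M[R]_(d, K) => x.2 i k));
    by apply: (@continuous_comp _ _ _ snd (fun v : 'M[R]_(d, K) => v i k));
      [exact: cvg_snd|exact: coord_continuous].
  move=> x; apply: continuousD.
    by apply: continuous_bigsum => i; exact: c1.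
  by apply: continuous_bigsum => k; apply: continuous_bigsum => i; exact: c2.
have : compact (f @` [set x | E x <= a]).
  by apply: continuous_compact => //; exact: continuous_subspaceT.
move=> /compact_bounded[N [_ /(_ (`|N| + 1))]] H.
have {}H x : E x <= a -> f x <= `|N| + 1.
  move=> Ex; have := H _ (f x); rewrite ltr_pwDr ?ler_norm// => /(_ isT).
  by move=> /(_ (ex_intro2 _ _ x Ex erefl)); exact: le_trans (ler_norm _).
have N1 : 1 <= `|N| + 1 by rewrite lerDr.
(* [|N| + 1] bounds the sum of all squared entries; being at least 1, it is below its own square and
   so bounds the norms too. *)
exists (`|N| + 1); first exact: lt_le_trans N1.
have sq : `|N| + 1 <= (`|N| + 1) ^+ 2.
  by rewrite expr2 ler_peMl// (le_trans _ N1).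
have s1 (x : 'cV[R]_d * 'M[R]_(d, K)) : 0 <= \sum_i x.1 i 0 ^+ 2.
  by apply: sumr_ge0 => i _; exact: sqr_ge0.
have s2 (x : 'cV[R]_d * 'M[R]_(d, K)) k : 0 <= \sum_i x.2 i k ^+ 2.
  by apply: sumr_ge0 => i _; exact: sqr_ge0.
move=> x /H fx; split=> [|k]; rewrite enorm_le ?(le_trans _ N1)//;
  apply: le_trans sq; apply: le_trans fx; rewrite /f.
  by rewrite lerDl; apply: sumr_ge0 => k _; exact: s2.
under eq_bigr do rewrite mxE.
apply: ler_wpDl; first exact: s1.
by rewrite (bigD1 k)//= lerDl; apply: sumr_ge0 => j _; exact: s2.
Qed.

End local_minorization.

(** * The transition kernel of the ensemble filter *)

Section generating_rectangles.

Lemma measurable_generated d (T : measurableType d) :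
  @measurable d T = <<s @measurable d T >>.
Proof. by rewrite smallest_id//; exact: sigma_algebra_measurable. Qed.

(** Since both generating families contain the whole space, the two projections are measurable for
    the sigma-algebra generated by the rectangles. *)
Lemma product_generated d1 d2 (T1 : measurableType d1) (T2 : measurableType d2)
    (G1 : set (set T1)) (G2 : set (set T2)) :
  @measurable d1 T1 = <<s G1 >> -> @measurable d2 T2 = <<s G2 >> ->
  G1 setT -> G2 setT ->
  @measurable _ (T1 * T2)%type = <<s [set A `*` B | A in G1 & B in G2] >>.
Proof.
move=> mG1 mG2 G1T G2T; pose G := [set A `*` B | A in G1 & B in G2].
apply/seteqP; split=> [W mW|]; last first.
  apply: smallest_sub; first exact: sigma_algebra_measurable.
  move=> _ [A GA [B GB <-]]; apply: measurableX.
    by rewrite mG1; exact: sub_gen_smallest.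
  by rewrite mG2; exact: sub_gen_smallest.
have mfst : measurable_fun setT (fun x : g_sigma_algebraType G => x.1).
  apply: (measurability _ mG1) => _ [A GA <-]; rewrite setTI.
  apply: sub_gen_smallest; exists A => //; exists setT => //.
  by apply/seteqP; split=> [x []|x].
have msnd : measurable_fun setT (fun x : g_sigma_algebraType G => x.2).
  apply: (measurability _ mG2) => _ [B GB <-]; rewrite setTI.
  apply: sub_gen_smallest; exists setT => //; exists B => //.
  by apply/seteqP; split=> [x []|x].
have mid : measurable_fun setT
    (fun x : g_sigma_algebraType G => (x.1, x.2) : T1 * T2).
  exact: measurable_fun_pair.
have := mid measurableT W mW.
rewrite setTI (_ : _ @^-1` W = W)//.
by apply/seteqP; split=> -[x y].
Qed.

Context (R : realType) (d K : nat).

Definition column_rectangles : set (set 'M[R]_(d, K)) :=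
  [set column_rectangle B | B in [set B | forall k, measurable (B k)]].

Lemma column_rectanglesT : column_rectangles setT.
Proof.
exists (fun=> setT); first by move=> k; exact: measurableT.
by apply/seteqP; split.
Qed.

Lemma column_rectanglesI : setI_closed column_rectangles.
Proof.
move=> _ _ [B mB <-] [C mC <-]; exists (fun k => B k `&` C k).
  by move=> k; exact: measurableI.
by apply/seteqP; split=> [M H|M [H1 H2] k]; [split=> k; case: (H k)|split].
Qed.

Lemma column_rectangles_generate :
  @measurable _ 'M[R]_(d, K) = <<s column_rectangles >>.
Proof.
apply/seteqP; split=> [W mW|]; last first.
  apply: smallest_sub; first exact: sigma_algebra_measurable.
  by move=> _ [B mB <-]; exact: measurable_column_rectangle.
have mid : measurable_fun setT
    (fun x : g_sigma_algebraType column_rectangles => x : 'M[R]_(d, K)).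
  apply: measurable_fun_mx => i k _ A mA; rewrite setTI.
  apply: sub_gen_smallest.
  exists (fun l => if l == k then (fun v : 'cV[R]_d => v i 0) @^-1` A else setT).
    move=> l; case: ifP => // _.
    by rewrite -[X in measurable X]setTI; exact: measurable_coord.
  apply/seteqP; split=> M /=; first by move/(_ k); rewrite eqxx /= mxE.
  by move=> MA l; case: eqVneq => [->|//]; rewrite /= mxE.
by have := mid measurableT W mW; rewrite setTI.
Qed.

End generating_rectangles.

Lemma emeasurable_prod (R : realType) d (T : measurableType d) I (s : seq I)
    (f : I -> T -> \bar R) : (forall i, measurable_fun setT (f i)) ->
  measurable_fun setT (fun t => \prod_(i <- s) f i t)%E.
Proof.
move=> mf; elim: s => [|i s IH].
  by under eq_fun do rewrite big_nil; exact: measurable_cst.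
by under eq_fun do rewrite big_cons; exact: emeasurable_funM.
Qed.

Lemma kernel_probability (R : realType) d1 d2 (T1 : measurableType d1)
    (T2 : measurableType d2) (kap : R.-pker T1 ~> T2) (x : T1) :
  exists p : probability T2 R, forall A, p A = kap x A.
Proof.
have k1 : kap x setT = 1%E by exact: prob_kernel.
exists (mnormalize (kap x) (\d_point)%R) => A.
change (mnormalize (kap x) (\d_point)%R A = kap x A).
by rewrite /mnormalize k1 onee_eq0 /= invr1 mule1.
Qed.

Lemma measurable_set1_mx (R : realType) m n (M : 'M[R]_(m, n)) :
  measurable [set M].
Proof.
rewrite (_ : [set M] = \bigcap_(i in [set: 'I_m]) \bigcap_(j in [set: 'I_n])
    ((fun A : 'M[R]_(m, n) => A i j) @^-1` [set M i j])); last first.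
  apply/seteqP; split=> [_ -> //|A AM]; apply/matrixP => i j.
  exact: (AM i I j I).
apply: fin_bigcap_measurable => // i _; apply: fin_bigcap_measurable => // j _.
by rewrite -[X in measurable X]setTI; exact: measurable_coord.
Qed.

Lemma measurable_set1_mx_prod (R : realType) m n p q
    (x : 'M[R]_(m, n) * 'M[R]_(p, q)) : measurable [set x].
Proof.
rewrite (_ : [set x] = [set x.1] `*` [set x.2]).
  by apply: measurableX; exact: measurable_set1_mx.
by case: x => a b; apply/seteqP; split=> [_ -> //|[c e] [/= -> ->]].
Qed.

(** * Joint law of the state and the next noises, and the transition kernel *)

Section etkf_law.
Context (R : realType) (q d K : nat) (H : 'M[R]_(q, d))
  (Psi : 'cV[R]_d -> 'cV[R]_d) (kap : R.-pker 'cV[R]_d ~> 'cV[R]_d)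
  (eta : probability 'cV[R]_q R) (dO : measure_display)
  (Omega : measurableType dO)
  (P : probability ('cV[R]_d * 'M[R]_(d, K))%type R -> probability Omega R)
  (U zeta : nat -> {mfun Omega >-> 'cV[R]_d})
  (V zetaV : nat -> {mfun Omega >-> 'M[R]_(d, K)})
  (Z xi : nat -> {mfun Omega >-> 'cV[R]_q}).
Context (mPsi : measurable_fun setT Psi)
  (dyn : etkf_dynamics H Psi U zeta V zetaV Z xi)
  (init : forall mu A, measurable A ->
    pushforward (P mu) (fun w => (U 0 w, V 0 w)) A = mu A)
  (noise : forall mu, etkf_noise kap eta (P mu) U zeta V zetaV xi).

Let S := ('cV[R]_d * 'M[R]_(d, K))%type.
Let N := ('cV[R]_d * 'M[R]_(d, K) * 'cV[R]_q)%type.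

Definition etkf_state n w : S := (U n w, V n w).
Definition etkf_noises n w : N := (zeta n w, zetaV n w, xi n w).

Lemma measurable_etkf_state n : measurable_fun setT (etkf_state n).
Proof. exact: measurable_fun_pair. Qed.

Lemma measurable_etkf_noises n : measurable_fun setT (etkf_noises n).
Proof. by do 2?apply: measurable_fun_pair. Qed.

Let joint n w : (S * N)%type := (etkf_state n w, etkf_noises n.+1 w).

Let mjoint n : measurable_fun setT (joint n).
Proof.
by apply: measurable_fun_pair; [exact: measurable_etkf_state|
  exact: measurable_etkf_noises].
Qed.

Definition etkf_state_mfun n : {mfun Omega >-> S} := HB.pack (etkf_state n)
  (isMeasurableFun.Build _ _ _ _ (etkf_state n) (measurable_etkf_state n)).

Let joint_mfun n : {mfun Omega >-> (S * N)%type} := HB.pack (joint n)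
  (isMeasurableFun.Build _ _ _ _ (joint n) (@mjoint n)).

Definition etkf_law mu n : probability S R :=
  distribution (P mu) (etkf_state_mfun n).

Definition etkf_joint_law mu n : probability (S * N)%type R :=
  distribution (P mu) (joint_mfun n).

Definition etkf_rectangle (D : set S) (B0 : set 'cV[R]_d)
    (B : 'I_K -> set 'cV[R]_d) (C : set 'cV[R]_q) : set (S * N)%type :=
  D `*` (B0 `*` column_rectangle B `*` C).

(** The conditional probability, given the state [x], that the next noises fall into the rectangle
    of sides [B0], [B] and [C]. *)
Definition noise_density (B0 : set 'cV[R]_d) (B : 'I_K -> set 'cV[R]_d)
    (C : set 'cV[R]_q) (x : S) : \bar R :=
  (kap x.1 B0 * (\prod_(k < K) kap (col k x.2) (B k)) * eta C)%E.

Lemma noise_density_ge0 B0 B C x : (0 <= noise_density B0 B C x)%E.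
Proof.
by rewrite /noise_density !mule_ge0//; apply: prode_ge0 => k _.
Qed.

Lemma measurable_noise_density B0 B C : measurable B0 ->
  (forall k, measurable (B k)) -> measurable_fun setT (noise_density B0 B C).
Proof.
move=> mB0 mB; apply: emeasurable_funM => //; apply: emeasurable_funM.
  apply: (measurableT_comp (measurable_kernel kap _ mB0)).
  exact: measurable_fst.
apply: emeasurable_prod => k.
apply: (measurableT_comp (measurable_kernel kap _ (mB k))).
by apply: measurable_col; exact: measurable_snd.
Qed.

Lemma etkf_past_state n (D : set S) : measurable D ->
  etkf_past U zeta V zetaV xi n (etkf_state n @^-1` D).
Proof.
move=> mD; rewrite /etkf_past; set F := (X in <<s X >>).
have mU : measurable_fun setT (fun w : g_sigma_algebraType F => U n w).
  move=> _ A mA; apply: sub_gen_smallest; left; exists n; first exact: leqnn.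
  by left; exists A.
have mV : measurable_fun setT (fun w : g_sigma_algebraType F => V n w).
  move=> _ A mA; apply: sub_gen_smallest; left; exists n; first exact: leqnn.
  by right; exists A.
have := measurable_fun_pair mU mV.
by move=> /(_ measurableT D mD); rewrite setTI.
Qed.

Lemma etkf_joint_rectangle mu n D B0 B C : measurable D -> measurable B0 ->
  (forall k, measurable (B k)) -> measurable C ->
  (etkf_joint_law mu n (etkf_rectangle D B0 B C) =
   \int[etkf_law mu n]_x (noise_density B0 B C \_ D) x)%E.
Proof.
move=> mD mB0 mB mC.
transitivity (P mu (etkf_state n @^-1` D `&` [set w | [/\ B0 (zeta n.+1 w),
    forall k, B k (col k (zetaV n.+1 w)) & C (xi n.+1 w)]])).
  congr (P mu _); apply/seteqP; split=> w /=.
    by case=> [? [[? ?] ?]].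
  by case=> [? [? ? ?]].
rewrite noise//; last exact: etkf_past_state.
rewrite -integral_mkcond.
apply/esym.
apply: (@ge0_integral_pushforward _ _ _ _ _ _ (measurable_etkf_state n) (P mu)).
- by [].
- by apply: measurable_funTS; exact: measurable_noise_density.
- by move=> x _; exact: noise_density_ge0.
Qed.

Definition etkf_step (t : (S * N)%type) : S :=
  let u := Psi t.1.1 + t.2.1.1 in
  (u, etkf_assimilate H (etkf_forecast Psi t.1.2 t.2.1.2) (H *m u + t.2.2)).

Lemma etkf_stateS n w :
  etkf_state n.+1 w = etkf_step (etkf_state n w, etkf_noises n.+1 w).
Proof.
by rewrite /etkf_state /etkf_step/=; have [-> -> ->] := dyn n w.
Qed.

Lemma measurable_etkf_step : measurable_fun setT etkf_step.
Proof.
have m11 : measurable_fun setT (fun t : S * N => t.1.1).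
  by apply: measurableT_comp measurable_fst; exact: measurable_fst.
have m12 : measurable_fun setT (fun t : S * N => t.1.2).
  by apply: measurableT_comp measurable_fst; exact: measurable_snd.
have m21 : measurable_fun setT (fun t : S * N => t.2.1).
  by apply: measurableT_comp measurable_snd; exact: measurable_fst.
have m22 : measurable_fun setT (fun t : S * N => t.2.2).
  by apply: measurableT_comp measurable_snd; exact: measurable_snd.
have m211 : measurable_fun setT (fun t : S * N => t.2.1.1).
  by apply: measurableT_comp m21; exact: measurable_fst.
have m212 : measurable_fun setT (fun t : S * N => t.2.1.2).
  by apply: measurableT_comp m21; exact: measurable_snd.
have mu : measurable_fun setT (fun t : S * N => Psi t.1.1 + t.2.1.1).
  by apply: measurable_addmx => //; exact: measurableT_comp m11.
apply: measurable_fun_pair => //; apply: measurable_etkf_assimilate.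
  exact: measurable_etkf_forecast.
by apply: measurable_addmx => //; exact: measurable_mulmx.
Qed.

Lemma etkf_law0 mu A : measurable A -> etkf_law mu 0 A = mu A.
Proof. exact: init. Qed.

Lemma etkf_joint_dirac_rectangle x D B0 B C : measurable D -> measurable B0 ->
  (forall k, measurable (B k)) -> measurable C ->
  (etkf_joint_law (\d_x)%R 0 (etkf_rectangle D B0 B C) =
   (noise_density B0 B C \_ D) x)%E.
Proof.
move=> mD mB0 mB mC; rewrite etkf_joint_rectangle//.
have mf : measurable_fun setT (noise_density B0 B C \_ D).
  by apply/(measurable_restrictT _ mD); apply: measurable_funTS;
    exact: measurable_noise_density.
rewrite (eq_measure_integral (\d_x)%R); last by move=> A mA _; exact: etkf_law0.
by rewrite integral_dirac// diracT mul1e.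
Qed.

Definition noise_rectangles : set (set N) :=
  [set A `*` B | A in [set A `*` B | A in @measurable _ 'cV[R]_d &
    B in @column_rectangles R d K] & B in @measurable _ 'cV[R]_q].

Lemma noise_rectanglesT : noise_rectangles setT.
Proof.
exists setT; last by exists setT => //; exact: setXTT.
by exists setT => //; exists setT; [exact: column_rectanglesT|exact: setXTT].
Qed.

Lemma noise_rectanglesI : setI_closed noise_rectangles.
Proof.
move=> _ _ [_ [A2 mA2 [A3 cA3 <-]] [A4 mA4 <-]]
  [_ [B2 mB2 [B3 cB3 <-]] [B4 mB4 <-]].
exists ((A2 `&` B2) `*` (A3 `&` B3)).
  exists (A2 `&` B2); first exact: measurableI.
  by exists (A3 `&` B3) => //; exact: column_rectanglesI.
by exists (A4 `&` B4); [exact: measurableI|rewrite !setXI].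
Qed.

Lemma noise_rectangles_generate : @measurable _ N = <<s noise_rectangles >>.
Proof.
apply: product_generated => //.
- apply: product_generated => //; first exact: measurable_generated.
    exact: column_rectangles_generate.
  exact: column_rectanglesT.
- exact: measurable_generated.
- by exists setT => //; exists setT; [exact: column_rectanglesT|exact: setXTT].
Qed.

Lemma etkf_rectangles_generate : @measurable _ (S * N)%type =
  <<s [set A `*` B | A in @measurable _ S & B in noise_rectangles] >>.
Proof.
apply: product_generated => //; first exact: measurable_generated.
  exact: noise_rectangles_generate.
exact: noise_rectanglesT.
Qed.

(* The joint law of the state and of the next noises started from a point is a
   kernel, and disintegrates every such joint law: this holds on rectangles by
   the definition of the noises, and extends by Dynkin's lemma. *)
Lemma etkf_joint_disintegration W : measurable W ->
  measurable_fun setT (fun x => etkf_joint_law (\d_x)%R 0 W) /\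
  forall mu n, (etkf_joint_law mu n W =
    \int[etkf_law mu n]_x etkf_joint_law (\d_x)%R 0 W)%E.
Proof.
rewrite etkf_rectangles_generate; move: W.
apply: dynkin_induction; first exact: etkf_rectangles_generate.
- move=> _ _ [A1 mA1 [A2 rA2 <-]] [B1 mB1 [B2 rB2 <-]].
  exists (A1 `&` B1); first exact: measurableI.
  by exists (A2 `&` B2); [exact: noise_rectanglesI|rewrite setXI].
- have E x : etkf_joint_law (\d_x)%R 0 setT = 1%E by exact: probability_setT.
  split; first by under eq_fun do rewrite E; exact: measurable_cst.
  move=> mu n; under eq_integral do rewrite E.
  rewrite integral_cst// mul1e.
  by apply: eq_trans (probability_setT _) (esym (probability_setT _)).
- move=> _ [D mD [_ [_ [B0 mB0 [_ [B mB <-] <-]] [C mC <-]] <-]].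
  split.
    apply: (eq_measurable_fun (noise_density B0 B C \_ D)).
      by move=> x _; rewrite -etkf_joint_dirac_rectangle.
    by apply/(measurable_restrictT _ mD); apply: measurable_funTS;
      exact: measurable_noise_density.
  move=> mu n; apply: eq_trans (etkf_joint_rectangle mu n mD mB0 mB mC) _.
  by apply: eq_integral => x _; rewrite -etkf_joint_dirac_rectangle.
- move=> W mW [mJ JE].
  have Jfin mu n A : measurable A -> etkf_joint_law mu n A \is a fin_num.
    by move=> mA; exact: fin_num_measure.
  have JC x : (etkf_joint_law (\d_x)%R 0 (~` W) =
      1 - etkf_joint_law (\d_x)%R 0 W)%E by exact: probability_setC.
  have mJC : measurable_fun setT (fun x => etkf_joint_law (\d_x)%R 0 (~` W)).
    by under eq_fun do rewrite JC; exact: emeasurable_funB.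
  split=> // mu n.
  rewrite (probability_setC (etkf_joint_law mu n))// JE.
  have : (\int[etkf_law mu n]_x (etkf_joint_law (\d_x)%R 0 (~` W) +
      etkf_joint_law (\d_x)%R 0 W) = 1)%E.
    rewrite (eq_integral (cst 1%E)).
      by rewrite integral_cst// mul1e; exact: probability_setT.
    by move=> x _ /=; rewrite JC subeK// Jfin.
  rewrite ge0_integralD// => <-; rewrite addeK//.
  by rewrite -JE; exact: Jfin.
- move=> F mF tF FP.
  have JU mu n : (etkf_joint_law mu n (\bigcup_k F k) =
      \sum_(0 <= k <oo) etkf_joint_law mu n (F k))%E.
    by apply: measure_semi_bigcup => //; exact: bigcup_measurable.
  split.
    under eq_fun do rewrite JU.
    by apply: ge0_emeasurable_sum => // k _; case: (FP k).
  move=> mu n; rewrite JU; under eq_integral do rewrite JU.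
  rewrite integral_nneseries//; last by move=> k; case: (FP k).
  by apply: eq_eseriesr => k _; case: (FP k).
Qed.

Definition etkf_kernel (x : S) : probability S R := etkf_law (\d_x)%R 1.

Lemma etkf_lawS_joint mu n A :
  etkf_law mu n.+1 A = etkf_joint_law mu n (etkf_step @^-1` A).
Proof.
congr (P mu _); apply/seteqP; split=> w.
  by rewrite /= etkf_stateS.
by rewrite /= etkf_stateS.
Qed.

Lemma measurable_etkf_step_preimage A : measurable A ->
  measurable (etkf_step @^-1` A).
Proof.
by move=> mA; rewrite -[X in measurable X]setTI; exact: measurable_etkf_step.
Qed.

Lemma measurable_etkf_kernel A : measurable A ->
  measurable_fun setT (fun x => etkf_kernel x A).
Proof.
move=> mA; rewrite /etkf_kernel; under eq_fun do rewrite etkf_lawS_joint.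
by case: (etkf_joint_disintegration (measurable_etkf_step_preimage mA)).
Qed.

Lemma etkf_lawS mu n A : measurable A ->
  (etkf_law mu n.+1 A = \int[etkf_law mu n]_x etkf_kernel x A)%E.
Proof.
move=> mA; rewrite etkf_lawS_joint /etkf_kernel.
under eq_integral do rewrite etkf_lawS_joint.
by case: (etkf_joint_disintegration (measurable_etkf_step_preimage mA)).
Qed.


Lemma etkf_kernel_minorized (S_ : 'cV[R]_d -> 'M[R]_d) (b c : R) (E : S -> R) :
  0 < b < 1 -> 0 < c -> (forall u, has_mean_cov (kap u) 0 (S_ u)) ->
  (forall u, enorm (Psi u) ^+ 2 + \tr (S_ u) <= (1 - b) * enorm u ^+ 2 + c) ->
  (forall M1 M2 : R, 0 < M1 -> 0 < M2 -> exists2 a : R, 0 < a &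
     forall u, enorm u <= M1 -> forall A, measurable A ->
       (a%:E * lebesgue_cV (A `&` [set x | (enorm x <= M2)%R])
        <= kap u A)%E) ->
  (forall a, compact [set x | E x <= a]) ->
  forall a : R, exists al : R, exists nu : probability S R, 0 < al /\
    (forall x, E x <= a -> forall A, measurable A ->
      (al%:E * nu A <= etkf_kernel x A)%E).
Proof.
move=> b01 c0 cov kin nondeg cE a.
have [l lP] := shifted_noise_minorized b01 c0 cov kin nondeg.
have [L LP] := independent_columns_minorized K l.
have [M M0 EM] := compact_sublevel_bound (cE a).
have [a0 a00 a0P] := lP M M0.
(* The analysis in terms of the forecasts and the observation noise. It does not involve the
   starting point, so [nu] is the same on the whole sublevel set. *)
pose G (y : N) : S := (y.1.1, etkf_assimilate H y.1.2 (H *m y.1.1 + y.2)).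
have m1 : measurable_fun setT (fun y : N => y.1.1).
  by apply: measurableT_comp measurable_fst; exact: measurable_fst.
have m2 : measurable_fun setT (fun y : N => y.1.2).
  by apply: measurableT_comp measurable_fst; exact: measurable_snd.
have mG : measurable_fun setT G.
  apply: measurable_fun_pair => //; apply: measurable_etkf_assimilate => //.
  by apply: measurable_addmx => //; exact: measurable_mulmx.
pose rho : probability N R := ((l \x L) \x eta)%E.
have [nu nuE] := probability_image rho mG.
(* One factor [a0] for the signal, one for each ensemble member, and 1 for the observation noise,
   whose law is kept. *)
exists (a0 * a0 ^+ K * 1), nu; split.
  by rewrite mulr1 mulr_gt0// exprn_gt0.
move=> x xa A mA; have [xM1 xM2] := EM x xa.
have mGA : measurable (G @^-1` A) by rewrite -[X in measurable X]setTI; exact: mG.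
have mshift (v : 'cV[R]_d) : measurable_fun setT (fun z : 'cV[R]_d => Psi v + z).
  exact: measurable_addmx.
have shift_ex v : exists p : probability 'cV[R]_d R,
    forall B, p B = kap v [set z | B (Psi v + z)].
  have [p pE] := kernel_probability kap v.
  have [p' p'E] := probability_image p (mshift v).
  by exists p' => B; rewrite p'E pE.
pose shifted v := projT1 (cid (shift_ex v)).
have shiftedE v B : shifted v B = kap v [set z | B (Psi v + z)].
  exact: projT2 (cid (shift_ex v)) B.
have [Q QE Qmin] := LP a0 (fun k => shifted (col k x.2)) (ltW a00) (fun k B mB =>
  le_trans (a0P _ (xM2 k) B mB) (eq_ind_r (fun t => (t <= _)%E) (lexx _)
  (esym (shiftedE _ B)))).
pose Pi : probability N R := ((shifted x.1 \x Q) \x eta)%E.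
(* [T] computes the forecasts with the state frozen at [x], so that they depend on the noises alone
   and their law is the product [Pi]. *)
pose T (t : S * N) : N := (Psi x.1 + t.2.1.1, etkf_forecast Psi x.2 t.2.1.2, t.2.2).
have mT : measurable_fun setT T.
  have n1 : measurable_fun setT (fun t : S * N => t.2.1).
    by apply: measurableT_comp measurable_snd; exact: measurable_fst.
  apply: measurable_fun_pair; last first.
    by apply: measurableT_comp measurable_snd; exact: measurable_snd.
  apply: measurable_fun_pair.
    apply: measurable_addmx => //.
    by apply: measurableT_comp n1; exact: measurable_fst.
  apply: measurable_etkf_forecast => //.
  by apply: measurableT_comp n1; exact: measurable_snd.
have [Lx LxE] := probability_image (etkf_joint_law (\d_x)%R 0) mT.
have mshiftB v B : measurable B -> measurable [set z | B (Psi v + z)].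
  by move=> mB; rewrite -[X in measurable X]setTI; exact: mshift.
have LxPi B : measurable B -> Lx B = Pi B.
  apply: (measure_unique noise_rectangles (fun=> setT)).
  - exact: noise_rectangles_generate.
  - exact: noise_rectanglesI.
  - by move=> _; exact: noise_rectanglesT.
  - by rewrite bigcup_const//; exists 0%N.
  - move=> _ [_ [B0 mB0 [_ [B' mB' <-] <-]] [C mC <-]].
    have mR := measurable_column_rectangle mB'.
    have PiE : Pi (B0 `*` column_rectangle B' `*` C) =
        (shifted x.1 B0 * Q (column_rectangle B') * eta C)%E.
      have mBR : measurable (B0 `*` column_rectangle B') by exact: measurableX.
      apply: eq_trans (@product_measure1E _ _ _ _ _ (shifted x.1 \x Q)%E eta
        _ _ mBR mC) _.
      congr (_ * _)%E.
      exact: (@product_measure1E _ _ _ _ _ (shifted x.1) Q _ _ mB0 mR).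
    apply: (eq_trans _ (esym PiE)); apply: (eq_trans (LxE _)).
    rewrite QE// (_ : T @^-1` _ = etkf_rectangle setT
      [set z | B0 (Psi x.1 + z)]
      (fun k => [set z | B' k (Psi (col k x.2) + z)]) C); last first.
      have colE v k : col k (etkf_forecast Psi x.2 v) =
          Psi (col k x.2) + col k v.
        by apply/matrixP => i j; rewrite !mxE ord1.
      apply/seteqP; split=> [[s y] /= [[? BR] ?]|[s y] /= [_ [[? BR] ?]]].
        by split=> //; split=> //; split=> // k; rewrite /= -colE; exact: BR.
      by split=> //; split=> // k; rewrite colE; exact: BR.
    apply: eq_trans (etkf_joint_dirac_rectangle x measurableT (mshiftB _ _ mB0)
      (fun k => mshiftB _ _ (mB' k)) mC) _.
    rewrite patchE in_setT /noise_density shiftedE; congr (_ * _ * _)%E.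
    by apply: eq_bigr => k _; rewrite shiftedE.
  - move=> _; apply: (@le_lt_trans _ _ 1%E); last exact: ltry.
    exact: probability_le1.
rewrite nuE.
apply: (@le_trans _ _ (Pi (G @^-1` A))).
  apply: minorized_product => //.
  - by rewrite mulr_ge0 ?exprn_ge0// ltW.
  - apply: minorized_product => //; rewrite ?exprn_ge0 ?ltW//.
    by move=> B mB; rewrite shiftedE; exact: a0P.
  - by move=> B mB; rewrite mul1e.
rewrite -LxPi// LxE.
have mx : measurable (~` [set x] `*` [set: N]).
  by apply: measurableX => //; apply: measurableC; exact: measurable_set1_mx_prod.
(* The chain starts at [x] almost surely, and where the state is [x] the true step is [G] after
   [T]. *)
have null : etkf_joint_law (\d_x)%R 0 (~` [set x] `*` [set: N]) = 0%E.
  rewrite (_ : _ `*` _ =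
      etkf_rectangle (~` [set x]) setT (fun=> setT) setT); last first.
    by apply/seteqP; split=> [[s y] [sx _]|[s y] [sx _]]; split.
  rewrite etkf_joint_dirac_rectangle//.
    by rewrite patchE memNset// => /(_ erefl).
  by apply: measurableC; exact: measurable_set1_mx_prod.
rewrite /etkf_kernel etkf_lawS_joint.
have mstep := measurable_etkf_step_preimage mA.
apply: (@le_trans _ _ (etkf_joint_law (\d_x)%R 0
    (etkf_step @^-1` A `|` (~` [set x] `*` [set: N])))).
  apply: le_measure; rewrite ?inE.
  - by rewrite -[X in measurable X]setTI; apply: mT.
  - exact: measurableU.
  - move=> [s y] /= TA; have [sx|sx] := pselect (s = x); last by right.
    by left; rewrite /= /etkf_step/= sx.
apply: (@le_trans _ _ (etkf_joint_law (\d_x)%R 0 (etkf_step @^-1` A) +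
    etkf_joint_law (\d_x)%R 0 (~` [set x] `*` [set: N])))%E.
  exact: measureU2.
by rewrite null adde0.
Qed.

(** For the chain started at [x], the conditional bound at time 0 is integrated over the whole
    space, where the initial law is the Dirac mass at [x]. *)
Lemma etkf_kernel_drift (E : S -> R) (b c : R) : measurable_fun setT E ->
  (forall x, 0 <= E x) -> 0 < b < 1 -> 0 < c ->
  (forall mu n, exists2 Y : Omega -> \bar R,
     is_cond_expectation (P mu) (natural_filtration etkf_state n)
       (fun w => (E (etkf_state n.+1 w))%:E) Y &
     {ae P mu, forall w, (Y w <= ((1 - b) * E (etkf_state n w) + c)%:E)%E}) ->
  forall x, (\int[etkf_kernel x]_y (E y)%:E <= ((1 - b) * E x + c)%:E)%E.
Proof.
move=> mE E0 /andP[b0 b1] c0 drift x.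
have [Y [Y0 Ymeas YE] Yle] := drift (\d_x)%R 0%N.
have mEE : measurable_fun setT (EFin \o E) by exact/measurable_EFinP.
have mEx : measurable_fun setT (fun y => ((1 - b) * E y + c)%:E).
  apply/measurable_EFinP; apply: measurable_funD => //.
  exact: measurable_funM.
have Ex0 y : (0 <= ((1 - b) * E y + c)%:E)%E.
  by rewrite lee_fin addr_ge0 ?mulr_ge0 ?(ltW c0)//; lra.
have filtration_measurable : natural_filtration etkf_state 0 `<=` measurable.
  apply: smallest_sub; first exact: sigma_algebra_measurable.
  by move=> _ [m _ [B mB <-]]; apply: measurable_etkf_state.
have mY : measurable_fun setT Y.
  by move=> _ B mB; apply: filtration_measurable; apply: Ymeas; exists B.
have -> : (\int[etkf_kernel x]_y (E y)%:E =
    \int[P (\d_x)%R]_w (E (etkf_state 1 w))%:E)%E.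
  apply: (@ge0_integral_pushforward _ _ _ _ _ _ (measurable_etkf_state 1)
    (P (\d_x)%R) setT (EFin \o E)) => // y _.
  by rewrite /= lee_fin.
rewrite -YE; last first.
  by rewrite -setC0; apply: sigma_algebraC; exact: sigma_algebra0.
apply: (@le_trans _ _
  (\int[P (\d_x)%R]_w ((1 - b) * E (etkf_state 0 w) + c)%:E)%E).
  apply: ae_ge0_le_integral => //.
    exact: (measurableT_comp mEx (measurable_etkf_state 0)).
  by apply: filterS Yle => w ? _.
have <- : (\int[etkf_law (\d_x)%R 0]_y ((1 - b) * E y + c)%:E =
    \int[P (\d_x)%R]_w ((1 - b) * E (etkf_state 0 w) + c)%:E)%E.
  by apply: (@ge0_integral_pushforward _ _ _ _ _ _ (measurable_etkf_state 0)
    (P (\d_x)%R) setT (fun y => ((1 - b) * E y + c)%:E)).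
rewrite (eq_measure_integral (\d_x)%R); last by move=> A mA _; exact: etkf_law0.
by rewrite integral_dirac// diracT mul1e.
Qed.

End etkf_law.

Theorem theorem5p6 (R : realType) (h : R) (q d K : nat)
    (H : 'M[R]_(q, d)) (Psi_h : 'cV[R]_d -> 'cV[R]_d)
    (R_h : 'cV[R]_d -> 'M[R]_d)
    (kap : R.-pker 'cV[R]_d ~> 'cV[R]_d) (eta : probability 'cV[R]_q R)
    (dO : measure_display) (Omega : measurableType dO)
    (P : probability ('cV[R]_d * 'M[R]_(d, K))%type R -> probability Omega R)
    (U zeta : nat -> {mfun Omega >-> 'cV[R]_d})
    (V zetaV : nat -> {mfun Omega >-> 'M[R]_(d, K)})
    (Z xi : nat -> {mfun Omega >-> 'cV[R]_q})
    (E : 'cV[R]_d * 'M[R]_(d, K) -> R) :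
  let X := fun n w => (U n w, V n w) in
  0 < h -> (1 <= q <= d)%N -> (2 <= K)%N -> \rank H = q ->
  measurable_fun setT Psi_h ->
  (forall u, has_mean_cov (kap u) 0 (R_h u)) ->
  has_mean_cov eta 0 1%:M ->
  etkf_dynamics H Psi_h U zeta V zetaV Z xi ->
  (forall mu A, measurable A -> pushforward (P mu) (X 0%N) A = mu A) ->
  (forall mu, etkf_noise kap eta (P mu) U zeta V zetaV xi) ->
  (* kinetic energy principle *)
  (exists beta_h K_h : R,
     [/\ 0 < beta_h < 1, 0 < K_h &
         forall u, enorm (Psi_h u) ^+ 2 + \tr (R_h u)
                   <= (1 - beta_h) * enorm u ^+ 2 + K_h]) ->
  (* nondegenerate system noise *)
  (forall M1 M2 : R, 0 < M1 -> 0 < M2 ->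
     exists2 alpha : R, 0 < alpha &
       forall u, enorm u <= M1 -> forall A, measurable A ->
         (alpha%:E * lebesgue_cV (A `&` [set x | (enorm x <= M2)%R])
          <= kap u A)%E) ->
  (* strong Lyapunov function *)
  (forall x, 0 <= E x) ->
  (forall a : R, compact [set x | E x <= a]) ->
  (exists beta c : R,
     [/\ 0 < beta < 1, 0 < c &
         forall mu n, exists2 Y : Omega -> \bar R,
           is_cond_expectation (P mu) (natural_filtration X n)
             (fun w => (E (X n.+1 w))%:E) Y &
           {ae P mu, forall w, (Y w <= ((1 - beta) * E (X n w) + c)%:E)%E}]) ->
  geometrically_ergodic P X E.
Proof.
move=> X _ _ _ _ mPsi cov _ dyn init noise [b0 [c0 [b01 c00 kin]]] nondeg E0 cE.
move=> [b [c [b1 c1 drift]]].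
have mE := measurable_fun_compact_sublevels cE.
have [|pi [inv uniq [r [kappa [r01 kappa0 rate]]]]] :=
  harris (measurable_etkf_kernel mPsi dyn init noise)
    (etkf_law0 init) (etkf_lawS mPsi dyn init noise)
    mE E0 b1 c1 (etkf_kernel_drift init mE E0 b1 c1 drift)
    (etkf_kernel_minorized mPsi dyn init noise b01 c00 cov kin nondeg cE).
  (* The origin is the starting point from which the invariant law is built. *)
  exact: (0, 0).
have invE (mu : probability ('cV[R]_d * 'M[R]_(d, K))%type R) A :
    measurable A -> pushforward (P mu) (X 1%N) A =
    (\int[mu]_x etkf_kernel P U V x A)%E.
  move=> mA.
  apply: (eq_trans (etkf_lawS mPsi dyn init noise mu 0 mA)).
  by apply: eq_measure_integral => B mB _; exact: (etkf_law0 init).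
exists pi; split.
- by move=> A mA; rewrite invE// inv.
- by move=> pi' pi'P A mA; apply: uniq => // B mB; rewrite -invE// pi'P.
- exists r, kappa; split=> // mu n.
  apply: ge_ereal_sup => _ [A mA <-]; exact: (rate mu n A mA).
Qed.
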